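(* Consider the leader-follower network, the cost $J_n^\gamma$, the mean-field sharing information structure and the matrices described in the context. Assume that at any time $t\in\{1,\dots,T\}$ the matrices $Q_t$ and $\bar Q_t$ are positive semi-definite and the matrices $R_t$ and $\bar R_t$ are positive definite. Then: 1. Given any $\gamma>0$, the problem of finding the saddle-point strategy $\mathbf g$ under the mean-field sharing information structure such that $J_n^{\gamma,*}=\inf_{\mathbf g}\sup_{\mathbf d}J_n^\gamma(\mathbf g,\mathbf d)$ admits a unique feedback saddle-point strategy if the matrices $\gamma^2\mathbf I_{\ell_x\times\ell_x}-\breve M_{t+1}$ and $\gamma^2\mathbf I_{2\ell_x\times2\ell_x}-\bar M_{t+1}$ are positive definite for every $t\in\{1,\dots,T-1\}$, where $\breve M_{t+1}$ and $\bar M_{t+1}$ are given by the backward recursion in the context. 2. The saddle-point strategy of the leader is described by $$u_t^0=\bar L_t^{1,1}x_t^0+\bar L_t^{1,2}\bar x_t,$$ and for every follower $i\in\{1,\dots,n\}$ $$u_t^i=\breve L_tx_t^i+\bar L_t^{2,1}x_t^0+(\bar L_t^{2,2}-\breve L_t)\bar x_t,$$ where $$\begin{bmatrix}\bar L_t^{1,1}&\bar L_t^{1,2}\\ \bar L_t^{2,1}&\bar L_t^{2,2}\end{bmatrix}:=-\bar R_t^{-1}\bar B_t^\intercal\bar M_{t+1}\bar\Delta_t^{-1}\bar A_t,\qquad \breve L_t:=-R_t^{-1}B_t^\intercal\breve M_{t+1}\breve\Delta_t^{-1}A_t .$$ 3. The performance under the saddle-point strategy is given by $$J_n^{\gamma,*}=\frac1n\sum_{i=1}^n\big[\mathrm{Tr}\big(\breve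 M_1\,\mathrm{Cov}(\breve x_1^i)\big)+\breve c_1^i\big]+\mathrm{Tr}\big(\bar M_1\,\mathrm{Cov}([x_1^0,\bar x_1])\big)+\bar c_1 .$$
   Context: **Dynamics.** A multi-agent system consists of one leader (index $0$) and $n\in\mathbb N$ homogeneous followers (indices $1,\dots,n$); $T\in\mathbb N$ is the control horizon. At time $t$, agent $i\in\{0,1,\dots,n\}$ has state $x_t^i\in\mathbb R^{\ell_x}$, action $u_t^i\in\mathbb R^{\ell_u}$, disturbance $d_t^i\in\mathbb R^{\ell_x}$ and noise $w_t^i\in\mathbb R^{\ell_x}$. For the followers define the averages $\bar x_t=\frac1n\sum_{i=1}^nx_t^i$ (called the mean-field), $\bar u_t=\frac1n\sum_{i=1}^nu_t^i$, $\bar w_t=\frac1n\sum_{i=1}^nw_t^i$, and the deviations $\breve x_t^i=x_t^i-\bar x_t$, $\breve w_t^i=w_t^i-\bar w_t$. The dynamics are $$x_{t+1}^0=A_t^0x_t^0+B_t^0u_t^0+S_t^0\bar x_t+d_t^0+w_t^0,$$ $$x_{t+1}^i=A_tx_t^i+B_tu_t^i+S_t\bar x_t+E_tx_t^0+d_t^i+w_t^i,\quad i=1,\dots,n,$$ with matrices of appropriate dimensions. The primitive random variables $x_1^0,x_1^1,\dots,x_1^n$ and $w_t^0,w_t^1,\dots,w_t^n$ ($t=1,\dots,T$) are mutually independent; the noises of the leader and followers have zero mean and finite covariance matrices. **Information structure.** Under mean-field sharing, $u_t^0=g_t^0(x_t^0,\bar x_t)$ with $g_t^0:\mathbb R^{2\ell_x}\to\mathbb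 R^{\ell_u}$, and $u_t^i=g_t^i(x_t^i,\bar x_t,x_t^0)$ with $g_t^i:\mathbb R^{3\ell_x}\to\mathbb R^{\ell_u}$, $i=1,\dots,n$. The set of all control laws $\mathbf g=\{g_{1:T}^0,g_{1:T}^1,\dots,g_{1:T}^n\}$ is called the strategy of the network, and $\mathbf d=\{d_{1:T}^0,\{d_{1:T}^i\}_{i=1}^n\}$ is the set of disturbances, where the subscript $1{:}T$ denotes the collection over times $1,\dots,T$. **Cost.** For a given attenuation parameter $\gamma>0$, $$J_n^\gamma(\mathbf g,\mathbf d)=\mathbb E\sum_{t=1}^T\Big[\frac1n\sum_{i=1}^n\big[(x_t^i)^\intercal Q_tx_t^i+(u_t^i)^\intercal R_tu_t^i-\gamma^2(d_t^i)^\intercal d_t^i\big]+(x_t^0)^\intercal Q_t^0x_t^0+(u_t^0)^\intercal R_t^0u_t^0-\gamma^2(d_t^0)^\intercal d_t^0+(\bar x_t-x_t^0)^\intercal F_t(\bar x_t-x_t^0)+\bar x_t^\intercal P_t\bar x_t+\bar u_t^\intercal H_t\bar u_t\Big],$$ where $Q_t,Q_t^0,R_t,R_t^0,F_t,P_t,H_t$ are symmetric matrices of appropriate dimensions. **Matrices.** For $t\in\{1,\dots,T\}$, $$\bar A_t=\begin{bmatrix}A_t^0&S_t^0\\ E_t&A_t+S_t\end{bmatrix},\ \bar B_t=\begin{bmatrix}B_t^0&\mathbf 0\\ \mathbf 0&B_t\end{bmatrix},\ \bar Q_t=\begin{bmatrix}Q_t^0+F_t&-F_t\\ -F_t&Q_t+P_t+F_t\end{bmatrix},\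 \bar R_t=\begin{bmatrix}R_t^0&\mathbf 0\\ \mathbf 0&H_t+R_t\end{bmatrix}.$$ Backward in time, with $\breve M_{T+1}=\mathbf 0_{\ell_x\times\ell_x}$, $\bar M_{T+1}=\mathbf 0_{2\ell_x\times2\ell_x}$, $\breve c_{T+1}^i=0$ ($i=1,\dots,n$), $\bar c_{T+1}=0$: $$\breve\Delta_t=\mathbf I_{\ell_x\times\ell_x}+B_tR_t^{-1}B_t^\intercal\breve M_{t+1}-\gamma^{-2}\breve M_{t+1},\qquad \bar\Delta_t=\mathbf I_{2\ell_x\times2\ell_x}+\bar B_t\bar R_t^{-1}\bar B_t^\intercal\bar M_{t+1}-\gamma^{-2}\bar M_{t+1},$$ $$\breve M_t=Q_t+A_t^\intercal\breve M_{t+1}\breve\Delta_t^{-1}A_t,\qquad \bar M_t=\bar Q_t+\bar A_t^\intercal\bar M_{t+1}\bar\Delta_t^{-1}\bar A_t,$$ $$\breve c_t^i=\breve c_{t+1}^i+\mathrm{Tr}(\breve M_{t+1}\mathrm{Cov}(\breve w_t^i)),\qquad \bar c_t=\bar c_{t+1}+\mathrm{Tr}(\bar M_{t+1}\mathrm{Cov}([w_t^0,\bar w_t])).$$ Here $\mathbf I$ and $\mathbf 0$ are identity and zero matrices, $\mathrm{Tr}$ is the trace, $\mathrm{Cov}$ is the covariance matrix of a random vector, and $[w_t^0,\bar w_t]$, $[x_1^0,\bar x_1]$ denote stacked vectors in $\mathbb R^{2\ell_x}$.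
   Formalization: Item 3 is stated for initial states with zero mean: with deterministic non-zero initial states and zero noise all covariances vanish, so the printed formula gives 0 although the value is positive in general. *)

(* Defs.v *)
From HB Require Import structures.
From mathcomp Require Import all_boot all_order all_algebra.
From mathcomp Require Import all_classical all_reals all_analysis.

Set Implicit Arguments.
Unset Strict Implicit.
Unset Printing Implicit Defensive.

Import Order.TTheory GRing.Theory Num.Theory.
Import numFieldNormedType.Exports.
Local Open Scope classical_set_scope.
Local Open Scope ring_scope.

Section LinearAlgebra.
Context {R : realType}.

Definition quad l (A : 'M[R]_l) (v : 'cV[R]_l) : R := (v^T *m A *m v) ord0 ord0.

Definition sqnorm l (v : 'cV[R]_l) : R := (v^T *m v) ord0 ord0.

Definition symmetric_mx l (A : 'M[R]_l) : Prop := A^T = A.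

Definition possemidef l (A : 'M[R]_l) : Prop :=
  symmetric_mx A /\ forall v : 'cV[R]_l, 0 <= quad A v.

Definition posdef l (A : 'M[R]_l) : Prop :=
  symmetric_mx A /\ forall v : 'cV[R]_l, v != 0 -> 0 < quad A v.

End LinearAlgebra.

(* Minimax Riccati recursion of the LQ game
     x_{t+1} = A_t x_t + B_t u_t + d_t,
     stage cost x' Q_t x + u' R_t u - gam^2 d' d. *)
Section Riccati.
Context {R : realType}.
Variables (l m : nat) (A : nat -> 'M[R]_l) (B : nat -> 'M[R]_(l, m)).
Variables (Q : nat -> 'M[R]_l) (Rm : nat -> 'M[R]_m) (gam : R) (T : nat).

Definition ric_delta (t : nat) (M : 'M[R]_l) : 'M[R]_l :=
  1%:M + B t *m invmx (Rm t) *m (B t)^T *m M - gam ^- 2 *: M.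

(* [ric_rev k] is the matrix at time [T + 1 - k], for [k <= T]. *)
Fixpoint ric_rev (k : nat) : 'M[R]_l :=
  if k is k'.+1 then
    let t := (T - k')%N in
    let M := ric_rev k' in
    Q t + (A t)^T *m M *m invmx (ric_delta t M) *m A t
  else 0.

Definition ric (t : nat) : 'M[R]_l := ric_rev (T.+1 - t).

Definition ric_gain (t : nat) : 'M[R]_(m, l) :=
  - (invmx (Rm t) *m (B t)^T *m ric t.+1 *m invmx (ric_delta t (ric t.+1))
       *m A t).

End Riccati.

Section RandomVectors.
Context {R : realType}.

Definition mx_cylinders m n : set (set 'M[R]_(m, n)) :=
  [set C | exists i j (U : set R),
     measurable U /\ C = (fun X : 'M[R]_(m, n) => X i j) @^-1` U].

(* Matrices with the product sigma-algebra of their entries, that is, the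
   Borel sigma-algebra. *)
Definition Rmx m n := g_sigma_algebraType (@mx_cylinders m n).

Definition mx_measurable m n p q (f : 'M[R]_(m, n) -> 'M[R]_(p, q)) : Prop :=
  measurable_fun [set: Rmx m n] (f : Rmx m n -> Rmx p q).

Context {d : measure_display} {Omega : measurableType d}.
Variable P : probability Omega R.

Definition mutually_independent m n (I : finType) (X : I -> Omega -> 'M[R]_(m, n))
    : Prop :=
  forall (J : {set I}) (U : I -> set (Rmx m n)),
    (forall i, measurable (U i)) ->
    fine (P (\bigcap_(i in [set` J]) (X i @^-1` U i)))
      = \prod_(i in J) fine (P (X i @^-1` U i)).

Definition square_integrable m n (X : Omega -> 'M[R]_(m, n)) : Prop :=
  forall i j, (fun w => X w i j) \in Lfun P 2%:E.

Definition centred m n (X : Omega -> 'M[R]_(m, n)) : Prop :=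
  forall i j, 'E_P[fun w => X w i j]%E = 0%E.

Definition Cov l (v : Omega -> 'cV[R]_l) : 'M[R]_l :=
  \matrix_(i, j) fine (covariance P (fun w => v w i ord0) (fun w => v w j ord0)).

End RandomVectors.

(* The states, actions, disturbances and noises of all the agents at a given
   time form one matrix, whose column 0 belongs to the leader and whose
   column [1 + i] belongs to the follower [i : 'I_n]. *)
Section Agents.
Context {R : realType} {n l : nat}.
Implicit Type X : 'M[R]_(l, 1 + n).

Definition leader X : 'cV[R]_l := lsubmx X.

Definition follower (i : 'I_n) X : 'cV[R]_l := col i (rsubmx X).

Definition joint (v0 : 'cV[R]_l) (v : 'I_n -> 'cV[R]_l) : 'M[R]_(l, 1 + n) :=
  row_mx v0 (\matrix_(k, i) v i k ord0).

Definition mean X : 'cV[R]_l := n%:R^-1 *: \sum_(i < n) follower i X.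

Definition deviation (i : 'I_n) X : 'cV[R]_l := follower i X - mean X.

Definition leader_mean X : 'cV[R]_(l + l) := col_mx (leader X) (mean X).

End Agents.

Record network (R : realType) (lx lu : nat) := Network {
  mA : nat -> 'M[R]_lx;  mB : nat -> 'M[R]_(lx, lu);
  mS : nat -> 'M[R]_lx;  mE : nat -> 'M[R]_lx;
  mA0 : nat -> 'M[R]_lx; mB0 : nat -> 'M[R]_(lx, lu); mS0 : nat -> 'M[R]_lx;
  mQ : nat -> 'M[R]_lx;  mR : nat -> 'M[R]_lu;
  mQ0 : nat -> 'M[R]_lx; mR0 : nat -> 'M[R]_lu;
  mF : nat -> 'M[R]_lx;  mP : nat -> 'M[R]_lx;  mH : nat -> 'M[R]_lu }.

Section NetworkMatrices.
Context {R : realType} {lx lu : nat}.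
Variable N : network R lx lu.

Definition barA t : 'M[R]_(lx + lx) :=
  block_mx (mA0 N t) (mS0 N t) (mE N t) (mA N t + mS N t).
Definition barB t : 'M[R]_(lx + lx, lu + lu) :=
  block_mx (mB0 N t) 0 0 (mB N t).
Definition barQ t : 'M[R]_(lx + lx) :=
  block_mx (mQ0 N t + mF N t) (- mF N t) (- mF N t) (mQ N t + mP N t + mF N t).
Definition barR t : 'M[R]_(lu + lu) :=
  block_mx (mR0 N t) 0 0 (mH N t + mR N t).

Variables (gam : R) (T : nat).

Definition breveM := ric (mA N) (mB N) (mQ N) (mR N) gam T.
Definition barM := ric barA barB barQ barR gam T.

Definition breveL := ric_gain (mA N) (mB N) (mQ N) (mR N) gam T.
Definition barL := ric_gain barA barB barQ barR gam T.

End NetworkMatrices.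

Section Game.
Context {R : realType} {n lx lu : nat}.
Context {d : measure_display} {Omega : measurableType d}.
Variables (P : probability Omega R) (N : network R lx lu) (gam : R) (T : nat).

(* The laws take the stacked vectors [x0; xbar] and [xi; xbar; x0]. *)
Record strategy := Strategy {
  leader_law : nat -> 'cV[R]_(lx + lx) -> 'cV[R]_lu;
  follower_law : nat -> 'I_n -> 'cV[R]_(lx + (lx + lx)) -> 'cV[R]_lu }.

Definition measurable_strategy (g : strategy) : Prop :=
  (forall t, mx_measurable (leader_law g t)) /\
  (forall t i, mx_measurable (follower_law g t i)).

Definition leader_action (g : strategy) t (X : 'M[R]_(lx, 1 + n)) : 'cV[R]_lu :=
  leader_law g t (col_mx (leader X) (mean X)).

Definition follower_action (g : strategy) t i (X : 'M[R]_(lx, 1 + n))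
    : 'cV[R]_lu :=
  follower_law g t i (col_mx (follower i X) (col_mx (mean X) (leader X))).

Definition actions (g : strategy) t X : 'M[R]_(lu, 1 + n) :=
  joint (leader_action g t X) (fun i => follower_action g t i X).

(* Two strategies are identified when they prescribe the same actions at every
   joint state: a follower law is not determined at triples [xi; xbar; x0] which
   no joint state produces (for n = 1, those with xi <> xbar). *)
Definition same_strategy (g g' : strategy) : Prop :=
  forall t X, (1 <= t <= T)%N -> actions g t X = actions g' t X.

(* The disturbances are chosen by state feedback: an open-loop choice could not
   react to the noise, and an anticipative one would foresee it. *)
Definition disturbance := nat -> 'M[R]_(lx, 1 + n) -> 'M[R]_(lx, 1 + n).

Definition dynamics t (X : 'M[R]_(lx, 1 + n)) (U : 'M[R]_(lu, 1 + n))
    (D W : 'M[R]_(lx, 1 + n)) : 'M[R]_(lx, 1 + n) :=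
  joint
    (mA0 N t *m leader X + mB0 N t *m leader U + mS0 N t *m mean X
       + leader D + leader W)
    (fun i => mA N t *m follower i X + mB N t *m follower i U
       + mS N t *m mean X + mE N t *m leader X + follower i D + follower i W).

Definition stage_cost t (X : 'M[R]_(lx, 1 + n)) (U : 'M[R]_(lu, 1 + n))
    (D : 'M[R]_(lx, 1 + n)) : R :=
  n%:R^-1 * (\sum_(i < n) (quad (mQ N t) (follower i X)
                           + quad (mR N t) (follower i U)
                           - gam ^+ 2 * sqnorm (follower i D)))
  + quad (mQ0 N t) (leader X) + quad (mR0 N t) (leader U)
  - gam ^+ 2 * sqnorm (leader D)
  + quad (mF N t) (mean X - leader X)
  + quad (mP N t) (mean X) + quad (mH N t) (mean U).

Variable w : nat -> Omega -> 'M[R]_(lx, 1 + n).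

(* The game that starts at time [s] in the (random) joint state [xi]. *)
Section Subgame.
Variables (s : nat) (xi : Omega -> 'M[R]_(lx, 1 + n)).

Fixpoint state_after (g : strategy) (dl : disturbance) (k : nat) (o : Omega)
    : 'M[R]_(lx, 1 + n) :=
  if k is k'.+1 then
    let t := (s + k')%N in
    let X := state_after g dl k' o in
    dynamics t X (actions g t X) (dl t X) (w t o)
  else xi o.

Definition state g dl t o := state_after g dl (t - s) o.

Definition cost (g : strategy) (dl : disturbance) : \bar R :=
  ('E_P[fun o => (\sum_(s <= t < T.+1)
     stage_cost t (state g dl t o) (actions g t (state g dl t o))
                  (dl t (state g dl t o)))%R])%E.

(* The disturbance has finite energy. The rest of the cost is nonnegative when
   Q, barQ, R and barR are positive semi-definite, so the expectation in [cost]
   is then well defined, possibly +oo. *)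
Definition admissible (g : strategy) (dl : disturbance) : Prop :=
  [/\ measurable_strategy g,
      forall t, mx_measurable (dl t) &
      forall t, (s <= t <= T)%N ->
        square_integrable P (fun o => dl t (state g dl t o))].

Definition saddle_point (g : strategy) (dl : disturbance) : Prop :=
  [/\ admissible g dl,
      forall dl', admissible g dl' -> (cost g dl' <= cost g dl)%E &
      forall g', admissible g' dl -> (cost g dl <= cost g' dl)%E].

Definition upper_cost (g : strategy) : \bar R :=
  ereal_sup [set cost g dl | dl in [set dl | admissible g dl]].

Definition minimax_value : \bar R :=
  ereal_inf [set upper_cost g | g in measurable_strategy].

End Subgame.

Variable x1 : Omega -> 'M[R]_(lx, 1 + n).

(* Feedback saddle points are strongly time consistent: a saddle point of the
   game, and of the subgames starting at any time in any state. *)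
Definition feedback_saddle_point (g : strategy) (dl : disturbance) : Prop :=
  saddle_point 1 x1 g dl /\
  forall s X, (1 <= s <= T)%N -> saddle_point s (cst X) g dl.

Definition feedback_saddle_strategy (g : strategy) : Prop :=
  exists dl, feedback_saddle_point g dl.

Definition primitive (p : 'I_T.+1 * 'I_(1 + n)) (o : Omega) : 'cV[R]_lx :=
  col p.2 (if val p.1 is t.+1 then w t.+1 o else x1 o).

(* [breve_c_rev i k] and [bar_c_rev k] are the constants at time [T + 1 - k]. *)
Fixpoint breve_c_rev (i : 'I_n) (k : nat) : R :=
  if k is k'.+1 then
    let t := (T - k')%N in
    breve_c_rev i k'
      + \tr (breveM N gam T t.+1 *m Cov P (fun o => deviation i (w t o)))
  else 0.
Definition breve_c i t := breve_c_rev i (T.+1 - t).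

Fixpoint bar_c_rev (k : nat) : R :=
  if k is k'.+1 then
    let t := (T - k')%N in
    bar_c_rev k' + \tr (barM N gam T t.+1 *m Cov P (fun o => leader_mean (w t o)))
  else 0.
Definition bar_c t := bar_c_rev (T.+1 - t).

Definition saddle_performance : R :=
  n%:R^-1 * (\sum_(i < n)
     (\tr (breveM N gam T 1 *m Cov P (fun o => deviation i (x1 o)))
      + breve_c i 1))
  + \tr (barM N gam T 1 *m Cov P (fun o => leader_mean (x1 o))) + bar_c 1.

End Game.

Arguments strategy R n lx lu : clear implicits.
Arguments disturbance R n lx : clear implicits.
Arguments primitive {R n lx d Omega} T w x1.

(* Main.v *)
From HB Require Import structures.
Require Import Defs.
From mathcomp Require Import all_boot all_order all_algebra.
From mathcomp Require Import all_classical all_reals all_analysis.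
From mathcomp Require Import measurable_realfun.
From mathcomp Require Import ring lra.

(** The deviations from the mean-field and the vector that stacks the leader's
    state on the mean-field evolve separately, and the cost is the average of
    one quadratic cost for each deviation plus one for the stacked vector
    ([deviation_dynamics], [leader_mean_dynamics], [stage_cost_energy]). So the
    network is a superposition of standard linear-quadratic games, and its value
    is the corresponding sum of Riccati quadratic forms.

    For one such game, completing the square around the saddle point
    [u = K x], [d = L x] of a stage gives the stage cost plus the value of the
    next state as the value of the present state plus a surplus, a quadratic
    form in the deviations [u - K x] and [d - L x] ([ric_square]). If the next
    Riccati matrix [M] is positive semidefinite and [gam^2 - M] is positive
    definite, then [Delta] is invertible, the new Riccati matrix is again
    positive semidefinite, and the surplus is positive when the control alone
    deviates and negative when the disturbance alone deviates. Summed along a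
    play, the values telescope ([play_cost]); the noise of a stage is centred
    and independent of the past, so only the means of its own values remain of
    it. Hence, when all second moments are finite, the expected cost is a
    constant plus the expected surpluses ([cost_square_integrable]).

    Second moments need care because strategies are only measurable. Positive
    definite control weights make the cost infinite as soon as some action is
    not square integrable ([finite_cost_actions]), so the saddle-point strategy
    minimizes the cost against the saddle-point disturbance. Against an
    arbitrary strategy that disturbance may be inadmissible; switching it off
    once the cost is already infinite restores admissibility, which gives the
    lower bound on the minimax value ([upper_cost_ge]).

    Uniqueness is a backward induction on the subgames that start at time [t] in
    a fixed state ([feedback_saddle_unique]). If the later laws are the
    saddle-point laws, then the two saddle-point inequalities, tested on
    deviations at time [t] only, squeeze both surpluses of that stage to zero;
    this determines the actions and the disturbances at time [t] in every
    state. *)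

Set Implicit Arguments.
Unset Strict Implicit.
Unset Printing Implicit Defensive.

Import Order.TTheory GRing.Theory Num.Theory.
Import numFieldNormedType.Exports.
Local Open Scope classical_set_scope.
Local Open Scope ring_scope.

(** * Quadratic forms and positive definite matrices *)

Section BilinearForms.
Context {R : realType}.

Definition dot l (u v : 'cV[R]_l) : R := (u^T *m v) ord0 ord0.

Lemma dotE l (u v : 'cV[R]_l) : dot u v = \sum_k u k ord0 * v k ord0.
Proof. by rewrite /dot mxE; apply: eq_bigr => k _; rewrite mxE. Qed.

Lemma dotC l (u v : 'cV[R]_l) : dot u v = dot v u.
Proof. by rewrite !dotE; apply: eq_bigr => k _; rewrite mulrC. Qed.

Lemma dotDr l (u v w : 'cV[R]_l) : dot u (v + w) = dot u v + dot u w.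
Proof. by rewrite /dot mulmxDr mxE. Qed.

Lemma dotDl l (u v w : 'cV[R]_l) : dot (v + w) u = dot v u + dot w u.
Proof. by rewrite dotC dotDr !(dotC u). Qed.

Lemma dotZr l a (u v : 'cV[R]_l) : dot u (a *: v) = a * dot u v.
Proof. by rewrite /dot -scalemxAr mxE. Qed.

Lemma dotZl l a (u v : 'cV[R]_l) : dot (a *: u) v = a * dot u v.
Proof. by rewrite dotC dotZr dotC. Qed.

Lemma dotNr l (u v : 'cV[R]_l) : dot u (- v) = - dot u v.
Proof. by rewrite -scaleN1r dotZr mulN1r. Qed.

Lemma dotNl l (u v : 'cV[R]_l) : dot (- u) v = - dot u v.
Proof. by rewrite dotC dotNr dotC. Qed.

Lemma dot0r l (u : 'cV[R]_l) : dot u 0 = 0.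
Proof. by rewrite /dot mulmx0 mxE. Qed.

Lemma dot0l l (u : 'cV[R]_l) : dot 0 u = 0.
Proof. by rewrite dotC dot0r. Qed.

Lemma dot_sumr l (I : finType) (u : 'cV[R]_l) (F : I -> 'cV[R]_l) :
  dot u (\sum_i F i) = \sum_i dot u (F i).
Proof. by rewrite /dot mulmx_sumr summxE. Qed.

Lemma dot_mul m l (A : 'M[R]_(m, l)) u v : dot (A *m u) v = dot u (A^T *m v).
Proof. by rewrite /dot trmx_mul mulmxA. Qed.

Lemma dot_symC l (A : 'M[R]_l) u v : symmetric_mx A ->
  dot u (A *m v) = dot v (A *m u).
Proof. by move=> sA; rewrite dotC dot_mul sA. Qed.

Lemma dot_col_mx l1 l2 (a c : 'cV[R]_l1) (b e : 'cV[R]_l2) :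
  dot (col_mx a b) (col_mx c e) = dot a c + dot b e.
Proof. by rewrite /dot tr_col_mx mul_row_col mxE. Qed.

Lemma dot_ge0 l (u : 'cV[R]_l) : 0 <= dot u u.
Proof. by rewrite dotE sumr_ge0// => k _; rewrite -expr2 sqr_ge0. Qed.

Lemma dot_eq0 l (u : 'cV[R]_l) : dot u u = 0 -> u = 0.
Proof.
rewrite dotE => /eqP; rewrite psumr_eq0; last first.
  by move=> k _; rewrite -expr2 sqr_ge0.
move=> /allP u0; apply/colP => k; rewrite mxE; apply/eqP.
by have := u0 k (mem_index_enum _); rewrite -expr2 sqrf_eq0.
Qed.

Lemma quadE l (A : 'M[R]_l) v : quad A v = dot v (A *m v).
Proof. by rewrite /quad /dot mulmxA. Qed.

Lemma sqnormE l (v : 'cV[R]_l) : sqnorm v = dot v v.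
Proof. by []. Qed.

Lemma quadD l (A B : 'M[R]_l) v : quad (A + B) v = quad A v + quad B v.
Proof. by rewrite !quadE mulmxDl dotDr. Qed.

Lemma quad_mx0 l (A : 'M[R]_l) : quad A 0 = 0.
Proof. by rewrite quadE dot0l. Qed.

Lemma quad0mx l (v : 'cV[R]_l) : quad 0 v = 0.
Proof. by rewrite quadE mul0mx dot0r. Qed.

Lemma sqnorm0 l : sqnorm (0 : 'cV[R]_l) = 0.
Proof. by rewrite sqnormE dot0l. Qed.

Lemma quad_add l (A : 'M[R]_l) u v : symmetric_mx A ->
  quad A (u + v) = quad A u + quad A v + 2 * dot u (A *m v).
Proof.
move=> sA; rewrite !quadE mulmxDr !dotDr !dotDl (dot_symC v u sA); ring.
Qed.

Lemma unitmx_inj l (A : 'M[R]_l) :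
  (forall v : 'cV[R]_l, A *m v = 0 -> v = 0) -> A \in unitmx.
Proof.
move=> injA; rewrite -unitmx_tr -row_free_unit -kermx_eq0; apply/rowV0P => v.
move=> /sub_kermxP vA; apply: trmx_inj; rewrite trmx0; apply: injA.
by rewrite -[A]trmxK -trmx_mul vA trmx0.
Qed.

Lemma posdef_unit l (A : 'M[R]_l) : posdef A -> A \in unitmx.
Proof.
move=> [_ A_gt0]; apply: unitmx_inj => v Av0; apply/eqP/negPn/negP => /A_gt0.
by rewrite quadE Av0 dot0r ltxx.
Qed.

Lemma posdef_ge0 l (A : 'M[R]_l) v : posdef A -> 0 <= quad A v.
Proof.
move=> [_ A_gt0]; have [->|/A_gt0/ltW//] := eqVneq v 0.
by rewrite quad_mx0.
Qed.

Lemma posdef_eq0 l (A : 'M[R]_l) v : posdef A -> quad A v <= 0 -> v = 0.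
Proof.
move=> [_ A_gt0] Av; apply/eqP/negPn/negP => /A_gt0.
by rewrite ltNge Av.
Qed.

Lemma posdef_inv l (A : 'M[R]_l) : posdef A -> possemidef (invmx A).
Proof.
move=> pA; have uA := posdef_unit pA; split=> [|v].
  by rewrite /symmetric_mx trmx_inv; case: pA => ->.
have -> : quad (invmx A) v = quad A (invmx A *m v).
  by rewrite !quadE mulmxA mulmxV// mul1mx dotC.
exact: posdef_ge0.
Qed.

(** The coordinate [v k] is the [A]-inner product of [v] with [A^-1 e_k], whose
    [A]-square is the diagonal entry [(A^-1) k k], so Cauchy-Schwarz bounds it.
    The trace of [A^-1] serves all the coordinates at once. *)
Lemma posdef_coord l (A : 'M[R]_l) : posdef A ->
  exists2 C : R, 0 < C & forall (v : 'cV[R]_l) k, v k ord0 ^+ 2 <= C * quad A v.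
Proof.
move=> pA; have uA := posdef_unit pA; have [sA _] := pA.
pose c k := quad (invmx A) (delta_mx k ord0).
have c_ge0 k : 0 <= c k by apply: (posdef_inv pA).2.
(* The summand [1] keeps the constant positive in dimension 0. *)
exists (1 + \sum_k c k) => [|v k].
  by rewrite ltr_wpDr// sumr_ge0.
pose z := invmx A *m delta_mx k ord0 : 'cV[R]_l.
pose C := 1 + \sum_k c k.
have Az : A *m z = delta_mx k ord0 by rewrite mulmxA mulmxV// mul1mx.
have vAz : dot v (A *m z) = v k ord0.
  rewrite Az dotE (bigD1 k)//= mxE !eqxx mulr1 big1 ?addr0// => j jk.
  by rewrite mxE (negbTE jk) mulr0.
have qz : quad A z = c k by rewrite /c !quadE Az dotC.
have ckC : 1 + c k <= C.
  by rewrite lerD2l (bigD1 k)//= lerDl sumr_ge0.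
(* The [A]-square of [v - x *: z] is least at [x = v k / c k]; here [C] stands
   for [c k], and the vector is scaled by [C]. *)
have := posdef_ge0 (C *: v - v k ord0 *: z) pA.
rewrite quad_add// !quadE !mulmxN -!scalemxAr !dotNl !dotNr !dotZr !dotZl opprK.
rewrite -!quadE qz vAz; rewrite -/C; move: (quad A v) (v k ord0) => q x.
have ck := c_ge0 k; move: (c k) ck ckC => ck ck0 ckC H.
have C0 : 0 < C by lra.
rewrite -(ler_pM2l C0).
have := sqr_ge0 x; nra.
Qed.

End BilinearForms.

(** * The minimax Riccati recursion *)

Section RiccatiTheory.
Context {R : realType}.
Variables (l m : nat) (A : nat -> 'M[R]_l) (B : nat -> 'M[R]_(l, m)).
Variables (Q : nat -> 'M[R]_l) (Rm : nat -> 'M[R]_m) (gam : R) (T : nat).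
Hypothesis Q_ge0 : forall t, (1 <= t <= T)%N -> possemidef (Q t).
Hypothesis R_gt0 : forall t, (1 <= t <= T)%N -> posdef (Rm t).
Hypothesis gam_gt0 : 0 < gam.

Notation M := (ric A B Q Rm gam T).
Notation Delta t := (ric_delta B Rm gam t (M t.+1)).
Notation K := (ric_gain A B Q Rm gam T).

Hypothesis gap : forall t, (1 <= t <= T - 1)%N ->
  posdef ((gam ^+ 2)%:M - M t.+1).

(** The gain of the worst disturbance, the counterpart of [ric_gain]. *)
Definition ric_worst t : 'M[R]_l :=
  gam ^- 2 *: (M t.+1 *m invmx (Delta t) *m A t).
Notation L := ric_worst.

Lemma ric_last : M T.+1 = 0.
Proof. by rewrite /ric subnn. Qed.

Lemma ricE t : (1 <= t <= T)%N ->
  M t = Q t + (A t)^T *m M t.+1 *m invmx (Delta t) *m A t.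
Proof.
move=> /andP[t1 tT]; rewrite /ric subSS subSn//=.
by rewrite subKn.
Qed.

Lemma ric_gap t : (1 <= t <= T)%N -> posdef ((gam ^+ 2)%:M - M t.+1).
Proof.
move=> /andP[t1]; rewrite leq_eqVlt => /orP[/eqP->|tT].
  rewrite ric_last subr0; split=> [|v v0]; first exact: tr_scalar_mx.
  rewrite quadE mul_scalar_mx dotZr mulr_gt0 ?exprn_gt0//.
  rewrite lt_neqAle dot_ge0 andbT.
  by apply/eqP => /esym/dot_eq0/eqP; rewrite (negbTE v0).
by apply: gap; rewrite t1 leq_subRL ?(leq_trans _ tT)// add1n.
Qed.

Lemma ric_gap_ge0 t v : (1 <= t <= T)%N ->
  quad (M t.+1) v <= gam ^+ 2 * dot v v.
Proof.
move=> /ric_gap/posdef_ge0 => /(_ v).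
by rewrite quadD !quadE mul_scalar_mx dotZr mulNmx dotNr subr_ge0.
Qed.

Lemma ric_gap_eq0 t v : (1 <= t <= T)%N ->
  gam ^+ 2 * dot v v <= quad (M t.+1) v -> v = 0.
Proof.
move=> /ric_gap/posdef_eq0 H ?; apply: H.
by rewrite quadD !quadE mul_scalar_mx dotZr mulNmx dotNr subr_le0 -quadE.
Qed.

(** With [p = M v], the difference is the [M]-square of [v - p / gam^2]
    plus the square of [p / gam^2] for the gap [gam^2 - M]; the latter is
    positive unless [p = 0]. *)
Lemma ric_attenuation t v : (1 <= t <= T)%N -> possemidef (M t.+1) ->
  0 <= quad (M t.+1) v - gam ^- 2 * dot (M t.+1 *m v) (M t.+1 *m v) /\
  (quad (M t.+1) v <= gam ^- 2 * dot (M t.+1 *m v) (M t.+1 *m v) ->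
   M t.+1 *m v = 0).
Proof.
move=> tT [sM M_ge0]; set p := M t.+1 *m v; pose g := gam ^- 2.
have g0 : 0 < g by rewrite invr_gt0 exprn_gt0.
have gg : gam ^+ 2 = g^-1 by rewrite invrK.
have := M_ge0 (v - g *: p).
rewrite quad_add// -scaleNr quadE -/p.
rewrite [dot v (_ *m (_ *: p))]dot_symC// -/p quadE -scalemxAr !dotZl !dotZr.
move=> Mvp; have Gp := ric_gap_ge0 p tT; rewrite gg in Gp.
have gq : g * quad (M t.+1) p <= dot p p.
  by rewrite -ler_pdivlMl.
rewrite -/g -[dot p (M _ *m p)]quadE in Mvp *; split; first by nra.
move=> le0; apply: (ric_gap_eq0 tT).
rewrite gg -(ler_pM2l g0) mulrA mulfV ?gt_eqF// mul1r -(ler_pM2l g0); lra.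
Qed.

(** If [Delta v = 0] and [p = M v], then pairing with [p] gives
    [v' M v - |p|^2 / gam^2 = - (B' p)' R^-1 (B' p) <= 0]. Hence [p = 0], and
    then [Delta v = v]. *)
Lemma ric_delta_unit t : (1 <= t <= T)%N -> possemidef (M t.+1) ->
  Delta t \in unitmx.
Proof.
move=> tT M_ge0; apply: unitmx_inj => v.
rewrite /ric_delta mulmxBl mulmxDl mul1mx -!scalemxAl -!mulmxA.
set p := M t.+1 *m v => eq0.
have : dot p (v + B t *m (invmx (Rm t) *m ((B t)^T *m p)) - gam ^- 2 *: p) = 0.
  by rewrite eq0 dot0r.
rewrite !dotDr dotNr dotZr [dot p v]dotC.
rewrite [dot p (B t *m _)]dotC dot_mul [dot (_ *m (_ *m _)) _]dotC -quadE.
have RB := (posdef_inv (R_gt0 tT)).2 ((B t)^T *m p).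
have [att0 att] := ric_attenuation v tT M_ge0; rewrite quadE -/p in att0 att.
move=> eq; have p0 : p = 0 by apply: att; lra.
by move: eq0; rewrite p0 !mulmx0 scaler0 subr0 addr0.
Qed.

Lemma ric_sym_step t : (1 <= t <= T)%N -> possemidef (M t.+1) ->
  symmetric_mx (M t.+1 *m invmx (Delta t)).
Proof.
move=> tT psM; have uD := ric_delta_unit tT psM; have [sM _] := psM.
have sR := (posdef_inv (R_gt0 tT)).1.
have DM : (Delta t)^T *m M t.+1 = M t.+1 *m Delta t.
  rewrite /ric_delta !linearD /= !linearN /= !linearZ /= trmx1 !trmx_mul trmxK.
  by rewrite !mulmxDl !scalerN !mulNmx mulmx1 mul1mx sM sR -scalemxAl !mulmxA.
have uDT : (Delta t)^T \in unitmx by rewrite unitmx_tr.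
rewrite /symmetric_mx trmx_mul sM trmx_inv.
by rewrite -[LHS]mulmx1 -(mulmxV uD) !mulmxA -[_ *m M _ *m Delta t]mulmxA -DM
  mulmxA mulVmx// mul1mx.
Qed.

(** For [y = Delta^-1 A v] and [p = M y], the second term of the recursion
    contributes [y' M y + (B' p)' R^-1 (B' p) - |p|^2 / gam^2], which is
    nonnegative by [ric_attenuation]. *)
Lemma ric_possemidef t : (1 <= t <= T.+1)%N -> possemidef (M t).
Proof.
move=> /andP[t1 tT]; rewrite -(subKn tT) in t1 *.
move: (T.+1 - t)%N t1 => k {tT}.
elim: k => [|k IHk] kT.
  rewrite subn0 ric_last; split=> [|v]; first by rewrite /symmetric_mx trmx0.
  by rewrite quad0mx.
rewrite subSS in kT *.
have kT' : (k <= T)%N by apply: ltnW; rewrite -subn_gt0.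
have tT : (1 <= T - k <= T)%N by rewrite kT leq_subr.
have psM : possemidef (M (T - k).+1).
  by rewrite -subSn//; apply: IHk; rewrite subSn.
set t' := (T - k)%N in psM tT *.
have uD := ric_delta_unit tT psM; have sS := ric_sym_step tT psM.
have [sQ Qge0] := Q_ge0 tT; rewrite ricE//; split=> [|v].
  rewrite /symmetric_mx linearD /= sQ -[(A t')^T *m _ *m _]mulmxA.
  by rewrite trmx_mul trmx_mul sS trmxK !mulmxA.
rewrite quadD addr_ge0//; set y := invmx (Delta t') *m (A t' *m v).
have Avy : A t' *m v = Delta t' *m y by rewrite /y mulmxA mulmxV// mul1mx.
set p := M t'.+1 *m y.
rewrite quadE -!mulmxA -/y -/p dotC dot_mul trmxK dotC Avy.
rewrite /ric_delta mulmxBl mulmxDl mul1mx -!scalemxAl -!mulmxA -/p.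
have yp : dot y p = quad (M t'.+1) y by rewrite quadE.
have Rp : dot (B t' *m (invmx (Rm t') *m ((B t')^T *m p))) p
    = quad (invmx (Rm t')) ((B t')^T *m p).
  by rewrite [LHS]dot_mul [LHS]dotC quadE.
rewrite !dotDl dotNl dotZl yp Rp.
rewrite -addrA addrCA addr_ge0//; first exact: (posdef_inv (R_gt0 tT)).2.
exact: (ric_attenuation y tT psM).1.
Qed.

(** The surplus, over the value of the one-stage game, caused by the
    deviations [v] and [e] of the control and of the disturbance from their
    saddle-point values. *)
Definition surplus t (v : 'cV[R]_m) (e : 'cV[R]_l) : R :=
  quad (Rm t) v - gam ^+ 2 * sqnorm e + quad (M t.+1) (B t *m v + e).

Lemma surplus0 t : surplus t 0 0 = 0.
Proof.
by rewrite /surplus mulmx0 addr0 !quad_mx0 sqnorm0 mulr0 subrr addr0.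
Qed.

(** At the saddle point the next state is [y = Delta^-1 A x], and the
    first-order conditions are [R u = - B' M y] and [gam^2 d = M y]: they cancel
    the terms that are linear in the deviations. *)
Lemma ric_square t x u e : (1 <= t <= T)%N ->
  quad (Q t) x + quad (Rm t) u - gam ^+ 2 * sqnorm e
    + quad (M t.+1) (A t *m x + B t *m u + e)
  = quad (M t) x + surplus t (u - K t *m x) (e - L t *m x).
Proof.
move=> tT; have [t1 tleT] := andP tT.
have psM : possemidef (M t.+1) by apply: ric_possemidef.
have [sM _] := psM; have [sR _] := R_gt0 tT.
have uD := ric_delta_unit tT psM; have uR := posdef_unit (R_gt0 tT).
set us := K t *m x; set es := L t *m x.
pose y := invmx (Delta t) *m (A t *m x).
have Rus : Rm t *m us = - ((B t)^T *m (M t.+1 *m y)).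
  rewrite /us /ric_gain mulNmx mulmxN !mulmxA mulmxV// mul1mx.
  by rewrite -!mulmxA.
have es' : es = gam ^- 2 *: (M t.+1 *m y).
  by rewrite /es /ric_worst -scalemxAl -!mulmxA.
have ges : gam ^+ 2 *: es = M t.+1 *m y.
  by rewrite es' scalerA divff ?scale1r ?expf_neq0 ?gt_eqF.
have us' : us = - (invmx (Rm t) *m ((B t)^T *m (M t.+1 *m y))).
  by rewrite -[LHS]mul1mx -(mulVmx uR) -mulmxA Rus mulmxN.
have Ax : A t *m x = y - B t *m us - es.
  have -> : A t *m x = Delta t *m y by rewrite /y mulmxA mulmxV// mul1mx.
  rewrite us' es' {1}/ric_delta mulmxBl mulmxDl mul1mx -!scalemxAl.
  by rewrite mulmxN opprK -!mulmxA.
have -> : A t *m x + B t *m u + e = y + (B t *m (u - us) + (e - es)).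
  rewrite Ax mulmxBr -!addrA; congr (_ + _); rewrite [RHS]addrCA; congr (_ + _).
  by rewrite addrCA; congr (_ + _); rewrite addrC.
have qM : quad (M t) x = quad (Q t) x + quad (M t.+1) y
    - dot us ((B t)^T *m (M t.+1 *m y)) - dot es (M t.+1 *m y).
  rewrite ricE// quadD -!addrA; congr (_ + _).
  rewrite quadE -!mulmxA -/y dotC dot_mul trmxK dotC Ax !dotDl !dotNl -quadE.
  by rewrite dot_mul addrA.
rewrite qM /surplus; clearbody us es y.
have [v ->] : exists v, u = us + v by exists (u - us); rewrite addrC subrK.
have [f ->] : exists f, e = es + f by exists (e - es); rewrite addrC subrK.
rewrite ![us + v]addrC ![es + f]addrC !addrK [v + us]addrC [f + es]addrC.
rewrite [quad (Rm t) (us + v)]quad_add// [quad _ (y + _)]quad_add//.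
rewrite [quad (Rm t) us]quadE !sqnormE [dot us (Rm t *m v)]dot_symC// Rus.
rewrite [dot y (M t.+1 *m _)]dot_symC// !dotDl !dotDr !dotNr.
rewrite [dot (B t *m v) _]dot_mul.
have esf h : dot h (M t.+1 *m y) = gam ^+ 2 * dot h es by rewrite -ges dotZr.
rewrite !esf (dotC es f); ring.
Qed.

(** The surplus is strictly convex in the control and, because of the gap
    [gam^2 - M], strictly concave in the disturbance. *)
Lemma surplus_control_ge0 t v : (1 <= t <= T)%N -> 0 <= surplus t v 0.
Proof.
move=> tT; have [t1 tleT] := andP tT.
rewrite /surplus sqnorm0 mulr0 subr0 addr_ge0//; first exact/posdef_ge0/R_gt0.
by apply: (ric_possemidef _).2.
Qed.

Lemma surplus_control_eq0 t v : (1 <= t <= T)%N -> surplus t v 0 <= 0 -> v = 0.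
Proof.
move=> tT; have [t1 tleT] := andP tT.
rewrite /surplus sqnorm0 mulr0 subr0 => le0; apply/(posdef_eq0 (R_gt0 tT)).
have : 0 <= quad (M t.+1) (B t *m v + 0) by apply: (ric_possemidef _).2.
lra.
Qed.

Lemma surplus_disturbance_le0 t e : (1 <= t <= T)%N -> surplus t 0 e <= 0.
Proof.
move=> tT; rewrite /surplus quad_mx0 mulmx0 !add0r.
have := ric_gap_ge0 e tT; rewrite sqnormE; lra.
Qed.

Lemma surplus_disturbance_eq0 t e : (1 <= t <= T)%N ->
  0 <= surplus t 0 e -> e = 0.
Proof.
move=> tT; rewrite /surplus quad_mx0 mulmx0 !add0r => ge0.
by apply: (ric_gap_eq0 tT); move: ge0; rewrite sqnormE; lra.
Qed.

End RiccatiTheory.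

(** * Deviations and leader-mean coordinates *)

Section AgentsTheory.
Context {R : realType} {n : nat}.

Section Linear.
Context {l : nat}.
Implicit Types (X Y : 'M[R]_(l, 1 + n)) (i : 'I_n).

Lemma leader_is_linear : linear (@leader R n l).
Proof. by move=> a X Y; apply/matrixP => j k; rewrite !mxE. Qed.
HB.instance Definition _ :=
  GRing.isLinear.Build R 'M[R]_(l, 1 + n) 'cV[R]_l _ (@leader R n l)
    leader_is_linear.

Lemma follower_is_linear i : linear (@follower R n l i).
Proof. by move=> a X Y; apply/matrixP => j k; rewrite !mxE. Qed.
HB.instance Definition _ i :=
  GRing.isLinear.Build R 'M[R]_(l, 1 + n) 'cV[R]_l _ (@follower R n l i)
    (follower_is_linear i).

Lemma mean_is_linear : linear (@mean R n l).
Proof.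
move=> a X Y.
rewrite /mean [a *: (_ *: _)]scalerA [a * _]mulrC -scalerA -scalerDr.
congr (_ *: _); rewrite scaler_sumr -big_split /=; apply: eq_bigr => i _.
by rewrite linearP.
Qed.
HB.instance Definition _ :=
  GRing.isLinear.Build R 'M[R]_(l, 1 + n) 'cV[R]_l _ (@mean R n l)
    mean_is_linear.

Lemma deviation_is_linear i : linear (@deviation R n l i).
Proof.
move=> a X Y; by rewrite /deviation !linearP /= scalerBr scalerN addrACA.
Qed.
HB.instance Definition _ i :=
  GRing.isLinear.Build R 'M[R]_(l, 1 + n) 'cV[R]_l _ (@deviation R n l i)
    (deviation_is_linear i).

Lemma leader_mean_is_linear : linear (@leader_mean R n l).
Proof.
by move=> a X Y; rewrite /leader_mean !linearP /= scale_col_mx add_col_mx.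
Qed.
HB.instance Definition _ :=
  GRing.isLinear.Build R 'M[R]_(l, 1 + n) 'cV[R]_(l + l) _ (@leader_mean R n l)
    leader_mean_is_linear.

Lemma leader_joint v0 v : leader (@joint R n l v0 v) = v0.
Proof. by rewrite /leader /joint row_mxKl. Qed.

Lemma follower_joint i v0 v : follower i (@joint R n l v0 v) = v i.
Proof.
rewrite /follower /joint row_mxKr; apply/colP => k; rewrite !mxE.
by [].
Qed.

Lemma joint_eta X : joint (leader X) (fun i => follower i X) = X.
Proof.
rewrite /joint -[RHS]hsubmxK; congr row_mx; apply/matrixP => k i.
by rewrite !mxE.
Qed.

Lemma agents_eq X Y : leader X = leader Y ->
  (forall i, follower i X = follower i Y) -> X = Y.
Proof.
by move=> l_eq f_eq; rewrite -[X]joint_eta -[Y]joint_eta l_eq (funext f_eq).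
Qed.

Hypothesis n_gt0 : (0 < n)%N.

Lemma natn_neq0 : n%:R != 0 :> R.
Proof. by rewrite pnatr_eq0 -lt0n. Qed.

Lemma sum_follower X : \sum_i follower i X = n%:R *: mean X.
Proof. by rewrite /mean scalerA divff ?scale1r ?natn_neq0. Qed.

Lemma sum_deviation X : \sum_i deviation i X = 0.
Proof.
by rewrite sumrB sum_follower sumr_const card_ord scaler_nat subrr.
Qed.

Lemma follower_deviation i X : follower i X = deviation i X + mean X.
Proof. by rewrite /deviation subrK. Qed.

Lemma deviation_eq X Y : leader_mean X = leader_mean Y ->
  (forall i, deviation i X = deviation i Y) -> X = Y.
Proof.
move=> /eq_col_mx[l_eq m_eq] d_eq; apply: agents_eq => // i.
by rewrite !follower_deviation d_eq m_eq.
Qed.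

(** Inverts the change of coordinates given by [leader_mean] and the
    deviations, on families of deviations that sum to zero. *)
Definition assemble (z : 'cV[R]_(l + l)) (f : 'I_n -> 'cV[R]_l) :=
  joint (usubmx z) (fun i => f i + dsubmx z).

Lemma assembleK z f : \sum_i f i = 0 ->
  leader_mean (assemble z f) = z /\ forall i, deviation i (assemble z f) = f i.
Proof.
move=> f0; have m_eq : mean (assemble z f) = dsubmx z.
  rewrite /mean; under eq_bigr do rewrite follower_joint.
  rewrite big_split /= f0 add0r sumr_const card_ord.
  rewrite -[dsubmx z *+ n]scaler_nat scalerA.
  by rewrite mulVf ?scale1r ?natn_neq0.
split=> [|i]; first by rewrite /leader_mean leader_joint m_eq vsubmxK.
by rewrite /deviation follower_joint m_eq addrK.
Qed.

(** The second moment of the followers is that of their deviations plus that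
    of their mean, because the deviations sum to zero. *)
Lemma quad_follower_sum (A : 'M[R]_l) X :
  n%:R^-1 * \sum_i quad A (follower i X)
  = n%:R^-1 * \sum_i quad A (deviation i X) + quad A (mean X).
Proof.
have -> : \sum_i quad A (follower i X)
    = \sum_i quad A (deviation i X) + n%:R * quad A (mean X).
  have quad_i i : quad A (follower i X) = quad A (deviation i X)
      + (dot (A *m mean X + A^T *m mean X) (deviation i X) + quad A (mean X)).
    rewrite follower_deviation; move: (deviation i X) (mean X) => v u.
    rewrite !quadE mulmxDr !(dotDl, dotDr).
    rewrite [dot (A *m _) _]dotC [dot (A^T *m _) _]dot_mul trmxK; ring.
  under eq_bigr do rewrite quad_i.
  rewrite !big_split /= sumr_const card_ord mulr_natl; congr (_ + _).
  by rewrite -dot_sumr sum_deviation dot0r add0r.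
by rewrite mulrDr mulrA mulVf ?natn_neq0// mul1r.
Qed.

End Linear.
End AgentsTheory.

(** * The value of the game and the surplus of a stage *)

Section NetworkGame.
Context {R : realType} {n lx lu : nat}.
Variables (N : network R lx lu) (gam : R) (T : nat).
Hypothesis n_gt0 : (0 < n)%N.
Implicit Types (X D W : 'M[R]_(lx, 1 + n)) (U : 'M[R]_(lu, 1 + n)).

Lemma dynamics_noise t X U D W :
  dynamics N t X U D W = dynamics N t X U D 0 + W.
Proof.
apply: agents_eq => [|i]; rewrite linearD /= ?leader_joint ?follower_joint.
  by rewrite !linear0 addr0.
by rewrite !linear0 addr0.
Qed.

Lemma mean_dynamics t X U D :
  mean (dynamics N t X U D 0) = mA N t *m mean X + mB N t *m mean U
    + mS N t *m mean X + mE N t *m leader X + mean D.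
Proof.
have sum_cst (v : 'cV[R]_lx) : \sum_(i < n) v = n%:R *: v.
  by rewrite sumr_const card_ord scaler_nat.
rewrite {1}/mean; under eq_bigr do rewrite follower_joint linear0 addr0.
rewrite !big_split /= -!mulmx_sumr !sum_follower// !sum_cst.
by rewrite -!scalemxAr -!scalerDr scalerA mulVf ?scale1r// natn_neq0.
Qed.

Lemma deviation_dynamics t X U D i :
  deviation i (dynamics N t X U D 0)
  = mA N t *m deviation i X + mB N t *m deviation i U + deviation i D.
Proof.
rewrite {1}/deviation mean_dynamics follower_joint linear0 addr0.
rewrite !follower_deviation !mulmxDr.
set a := mA N t *m deviation i X; set b := mB N t *m deviation i U.
set e := deviation i D; clearbody a b e.
move: (mA N t *m _) (mB N t *m _) (mS N t *m _) (mE N t *m _) (mean D).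
by move=> x u s z v; apply/colP => k; rewrite !mxE; ring.
Qed.

Lemma leader_mean_dynamics t X U D :
  leader_mean (dynamics N t X U D 0)
  = barA N t *m leader_mean X + barB N t *m leader_mean U + leader_mean D.
Proof.
rewrite {1}/leader_mean mean_dynamics leader_joint linear0 addr0.
rewrite /barA /barB /leader_mean !mul_block_col !mul0mx add0r addr0 !add_col_mx.
rewrite mulmxDl; congr col_mx; congr (_ + _).
  by rewrite -!addrA; congr (_ + _); rewrite addrC.
rewrite -!addrA [RHS]addrC -!addrA; congr (_ + _).
by rewrite [RHS]addrCA; congr (_ + _); rewrite addrC.
Qed.

Lemma quad_barQ t X : quad (barQ N t) (leader_mean X)
  = quad (mQ0 N t) (leader X) + quad (mF N t) (mean X - leader X)
    + quad (mP N t) (mean X) + quad (mQ N t) (mean X).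
Proof.
rewrite quadE /barQ /leader_mean mul_block_col dot_col_mx !quadE.
rewrite !mulmxDl !mulNmx mulmxBr !dotDr !dotNr !dotDl !dotNl; ring.
Qed.

Lemma quad_barR t U : quad (barR N t) (leader_mean U)
  = quad (mR0 N t) (leader U) + quad (mH N t) (mean U) + quad (mR N t) (mean U).
Proof.
rewrite quadE /barR /leader_mean mul_block_col dot_col_mx !quadE.
rewrite !mul0mx addr0 add0r mulmxDl !dotDr; ring.
Qed.

Lemma sqnorm_quad l (v : 'cV[R]_l) : sqnorm v = quad 1%:M v.
Proof. by rewrite quadE mul1mx. Qed.

Definition energy l (D : 'M[R]_(l, 1 + n)) : R :=
  n%:R^-1 * (\sum_(i < n) sqnorm (follower i D)) + sqnorm (leader D).

(** In the coordinates given by the deviations and the leader-mean vector, the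
    cost has no cross term. *)
Lemma stage_cost_energy t X U D :
  stage_cost N gam t X U D
  = n%:R^-1 * (\sum_i (quad (mQ N t) (deviation i X)
                       + quad (mR N t) (deviation i U)))
    + quad (barQ N t) (leader_mean X) + quad (barR N t) (leader_mean U)
    - gam ^+ 2 * energy D.
Proof.
rewrite /stage_cost quad_barQ quad_barR /energy sumrB -mulr_sumr !big_split /=.
rewrite !mulrBr !mulrDr !quad_follower_sum//; ring.
Qed.

Lemma energy_split l (D : 'M[R]_(l, 1 + n)) :
  energy D = n%:R^-1 * (\sum_i sqnorm (deviation i D)) + sqnorm (leader_mean D).
Proof.
rewrite /energy /leader_mean; under eq_bigr do rewrite sqnorm_quad.
rewrite quad_follower_sum// -sqnorm_quad [sqnorm (col_mx _ _)]dot_col_mx.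
by under eq_bigr do rewrite -sqnorm_quad; rewrite !sqnormE; ring.
Qed.

Hypothesis cost_pos : forall t, (1 <= t <= T)%N ->
  [/\ possemidef (mQ N t), possemidef (barQ N t),
      posdef (mR N t) & posdef (barR N t)].
Hypothesis gam_gt0 : 0 < gam.
Hypothesis gam_pos : forall t, (1 <= t <= T - 1)%N ->
  posdef ((gam ^+ 2)%:M - breveM N gam T t.+1) /\
  posdef ((gam ^+ 2)%:M - barM N gam T t.+1).

Let Q_ge0 t : (1 <= t <= T)%N -> possemidef (mQ N t).
Proof. by case/cost_pos. Qed.
Let barQ_ge0 t : (1 <= t <= T)%N -> possemidef (barQ N t).
Proof. by case/cost_pos. Qed.
Let R_gt0 t : (1 <= t <= T)%N -> posdef (mR N t).
Proof. by case/cost_pos. Qed.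
Let barR_gt0 t : (1 <= t <= T)%N -> posdef (barR N t).
Proof. by case/cost_pos. Qed.
Let gap t : (1 <= t <= T - 1)%N -> posdef ((gam ^+ 2)%:M - breveM N gam T t.+1).
Proof. by case/gam_pos. Qed.
Let bar_gap t : (1 <= t <= T - 1)%N ->
  posdef ((gam ^+ 2)%:M - barM N gam T t.+1).
Proof. by case/gam_pos. Qed.

Definition breveW := ric_worst (mA N) (mB N) (mQ N) (mR N) gam T.
Definition barW := ric_worst (barA N) (barB N) (barQ N) (barR N) gam T.

Definition saddle_action t X : 'M[R]_(lu, 1 + n) :=
  assemble (barL N gam T t *m leader_mean X)
           (fun i => breveL N gam T t *m deviation i X).

Definition saddle_disturbance t X : 'M[R]_(lx, 1 + n) :=
  assemble (barW t *m leader_mean X) (fun i => breveW t *m deviation i X).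

Definition value t X : R :=
  n%:R^-1 * (\sum_i quad (breveM N gam T t) (deviation i X))
  + quad (barM N gam T t) (leader_mean X).

(** The bilinear form of which [value t] is the quadratic form. *)
Definition value_form t X Y : R :=
  n%:R^-1 * (\sum_i dot (deviation i X) (breveM N gam T t *m deviation i Y))
  + dot (leader_mean X) (barM N gam T t *m leader_mean Y).

Definition game_surplus t U D : R :=
  n%:R^-1 * (\sum_i surplus (mA N) (mB N) (mQ N) (mR N) gam T t
                      (deviation i U) (deviation i D))
  + surplus (barA N) (barB N) (barQ N) (barR N) gam T t
      (leader_mean U) (leader_mean D).

Lemma value_last X : value T.+1 X = 0.
Proof.
rewrite /value /breveM /barM !ric_last quad0mx addr0 big1 ?mulr0// => i _.
exact: quad0mx.
Qed.

Lemma valueD t X Y : (1 <= t <= T.+1)%N ->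
  value t (X + Y) = value t X + value t Y + 2 * value_form t X Y.
Proof.
move=> tT; have [sM _] := ric_possemidef Q_ge0 R_gt0 gam_gt0 gap tT.
have [sN _] := ric_possemidef barQ_ge0 barR_gt0 gam_gt0 bar_gap tT.
rewrite /value /value_form linearD /= (quad_add _ _ sN).
under eq_bigr => i _ do rewrite linearD /= (quad_add _ _ sM).
rewrite !big_split /= -mulr_sumr; ring.
Qed.

Lemma saddle_action_split t X :
  leader_mean (saddle_action t X) = barL N gam T t *m leader_mean X /\
  forall i, deviation i (saddle_action t X) = breveL N gam T t *m deviation i X.
Proof. by apply: assembleK; rewrite // -mulmx_sumr sum_deviation// mulmx0. Qed.

Lemma saddle_disturbance_split t X :
  leader_mean (saddle_disturbance t X) = barW t *m leader_mean X /\
  forall i, deviation i (saddle_disturbance t X) = breveW t *m deviation i X.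
Proof. by apply: assembleK; rewrite // -mulmx_sumr sum_deviation// mulmx0. Qed.

(** The deviations and the leader-mean vector evolve separately and contribute
    separate terms to the cost, so [ric_square] applies to each of them. *)
Lemma stage_value t X U D : (1 <= t <= T)%N ->
  stage_cost N gam t X U D + value t.+1 (dynamics N t X U D 0)
  = value t X + game_surplus t (U - saddle_action t X)
                               (D - saddle_disturbance t X).
Proof.
move=> tT; rewrite stage_cost_energy energy_split /value /game_surplus.
have [am ad] := saddle_action_split t X.
have [dm dd] := saddle_disturbance_split t X.
have sq_bar := ric_square barQ_ge0 barR_gt0 gam_gt0 bar_gap
  (leader_mean X) (leader_mean U) (leader_mean D) tT.
have sq_breve i := ric_square Q_ge0 R_gt0 gam_gt0 gap
  (deviation i X) (deviation i U) (deviation i D) tT.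
rewrite -/(barL N gam T t) -/(barW t) -am -dm -!linearB in sq_bar.
have {sq_breve}breve_sum :
  \sum_i quad (breveM N gam T t.+1) (deviation i (dynamics N t X U D 0))
  = \sum_i quad (breveM N gam T t) (deviation i X)
    + \sum_i surplus (mA N) (mB N) (mQ N) (mR N) gam T t
        (deviation i (U - saddle_action t X))
        (deviation i (D - saddle_disturbance t X))
    - \sum_i (quad (mQ N t) (deviation i X) + quad (mR N t) (deviation i U))
    + gam ^+ 2 * \sum_i sqnorm (deviation i D).
  rewrite mulr_sumr -big_split -sumrB -big_split /=; apply: eq_bigr => i _.
  rewrite deviation_dynamics; have := sq_breve i.
  rewrite -/(breveL N gam T t) -/(breveW t) -ad -dd -!linearB /breveM => <-.
  ring.
rewrite breve_sum leader_mean_dynamics.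
move: sq_bar; rewrite /barM.
move: (quad (ric _ _ _ _ _ _ t.+1) _) => z sq_bar.
have -> : z
    = quad (ric (barA N) (barB N) (barQ N) (barR N) gam T t) (leader_mean X)
      + surplus (barA N) (barB N) (barQ N) (barR N) gam T t
          (leader_mean (U - saddle_action t X))
          (leader_mean (D - saddle_disturbance t X))
      - (quad (barQ N t) (leader_mean X) + quad (barR N t) (leader_mean U)
         - gam ^+ 2 * sqnorm (leader_mean D)) by rewrite -sq_bar; ring.
ring.
Qed.

Lemma game_surplus0 t : game_surplus t 0 0 = 0.
Proof.
rewrite /game_surplus !linear0 surplus0 addr0 big1 ?mulr0// => i _.
by rewrite !linear0 surplus0.
Qed.

(** Together with [game_surplus_disturbance]: the one-stage game has a strict
    saddle point, hence only one. *)
Lemma game_surplus_action t U : (1 <= t <= T)%N ->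
  0 <= game_surplus t U 0 /\ (game_surplus t U 0 <= 0 -> U = 0).
Proof.
move=> tT; rewrite /game_surplus linear0.
under eq_bigr do rewrite linear0.
have s1 i := surplus_control_ge0 Q_ge0 R_gt0 gam_gt0 gap (deviation i U) tT.
have s2 := surplus_control_ge0 barQ_ge0 barR_gt0 gam_gt0 bar_gap
  (leader_mean U) tT.
have S1 := sumr_ge0 _ (fun i _ => s1 i).
have n0 : 0 < n%:R^-1 :> R by rewrite invr_gt0 ltr0n.
split=> [|le0]; first by rewrite addr_ge0// mulr_ge0// ltW.
have S1' := mulr_ge0 (ltW n0) (S1 (index_enum _) xpredT).
apply: deviation_eq; rewrite ?linear0.
  by apply: (surplus_control_eq0 barQ_ge0 barR_gt0 gam_gt0 bar_gap tT); lra.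
move=> i; rewrite linear0.
apply: (surplus_control_eq0 Q_ge0 R_gt0 gam_gt0 gap tT).
have : n%:R^-1 * (\sum_i surplus (mA N) (mB N) (mQ N) (mR N) gam T t
   (deviation i U) 0) <= 0 by lra.
rewrite pmulr_rle0// (bigD1 i)//=; apply: le_trans.
by rewrite lerDl sumr_ge0.
Qed.

Lemma game_surplus_disturbance t D : (1 <= t <= T)%N ->
  game_surplus t 0 D <= 0 /\ (0 <= game_surplus t 0 D -> D = 0).
Proof.
move=> tT; rewrite /game_surplus linear0.
under eq_bigr do rewrite linear0.
have s1 i := surplus_disturbance_le0 gam_gt0 gap (deviation i D) tT.
have s2 := surplus_disturbance_le0 gam_gt0 bar_gap (leader_mean D) tT.
have S1 := sumr_le0 _ (fun i _ => s1 i).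
have n0 : 0 < n%:R^-1 :> R by rewrite invr_gt0 ltr0n.
have S1' := mulr_ge0_le0 (ltW n0) (S1 (index_enum _) xpredT).
split=> [|ge0]; first by lra.
apply: deviation_eq; rewrite ?linear0.
  by apply: (surplus_disturbance_eq0 gam_gt0 bar_gap tT); lra.
move=> i; rewrite linear0.
apply: (surplus_disturbance_eq0 gam_gt0 gap tT).
have : 0 <= n%:R^-1 * (\sum_i surplus (mA N) (mB N) (mQ N) (mR N) gam T t
   0 (deviation i D)) by lra.
rewrite pmulr_rge0// (bigD1 i)//=; move=> /le_trans; apply.
by rewrite gerDl sumr_le0.
Qed.

Lemma stage_cost_ge0 t X U D : (1 <= t <= T)%N ->
  0 <= stage_cost N gam t X U D + gam ^+ 2 * energy D.
Proof.
move=> tT; rewrite stage_cost_energy subrK.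
rewrite !addr_ge0 ?mulr_ge0 ?invr_ge0 ?ler0n//.
- apply: sumr_ge0 => i _; apply: addr_ge0; first exact: (Q_ge0 tT).2.
  exact/posdef_ge0/R_gt0.
- exact: (barQ_ge0 tT).2.
- exact/posdef_ge0/barR_gt0.
Qed.

(** The positive definite control weights make the cost control the actions:
    [posdef_coord] bounds the deviations and the mean of the actions. *)
Lemma stage_cost_coercive t : (1 <= t <= T)%N ->
  exists2 C : R, 0 < C & forall X U D k j,
    U k j ^+ 2 <= C * (stage_cost N gam t X U D + gam ^+ 2 * energy D).
Proof.
move=> tT; have [C1 C1_gt0 bound1] := posdef_coord (R_gt0 tT).
have [C2 C2_gt0 bound2] := posdef_coord (barR_gt0 tT).
have n0 : 0 < n%:R :> R by rewrite ltr0n.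
exists (2 * (n%:R * C1) + 2 * C2) => [|X U D k j].
  by rewrite addr_gt0 ?mulr_gt0 ?ltr0n.
set c := _ + gam ^+ 2 * _.
have c_ge : n%:R^-1 * (\sum_i quad (mR N t) (deviation i U))
    + quad (barR N t) (leader_mean U) <= c.
  rewrite /c stage_cost_energy subrK big_split /= mulrDr.
  have h1 : 0 <= n%:R^-1 * (\sum_i quad (mQ N t) (deviation i X)).
    rewrite mulr_ge0 ?invr_ge0 ?ler0n// sumr_ge0// => i _.
    exact: (Q_ge0 tT).2.
  have h2 := (barQ_ge0 tT).2 (leader_mean X).
  lra.
have bar_ge0 := posdef_ge0 (leader_mean U) (barR_gt0 tT).
have dev_ge0 i := posdef_ge0 (deviation i U) (R_gt0 tT).
have sum_ge0 : 0 <= \sum_i quad (mR N t) (deviation i U) by apply: sumr_ge0.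
have sum_ge0' : 0 <= n%:R^-1 * (\sum_i quad (mR N t) (deviation i U)).
  by rewrite mulr_ge0 ?invr_ge0 ?ler0n.
have bar_le : quad (barR N t) (leader_mean U) <= c by lra.
have dev_le i : quad (mR N t) (deviation i U) <= n%:R * c.
  rewrite -ler_pdivrMl//; apply: le_trans
    (_ : n%:R^-1 * (\sum_i quad (mR N t) (deviation i U)) <= _); last by lra.
  rewrite ler_pM2l ?invr_gt0// (bigD1 i)//= lerDl; exact: sumr_ge0.
have c_ge0 : 0 <= c by exact: le_trans bar_ge0 bar_le.
have nC : 0 < n%:R * C1 by rewrite mulr_gt0.
have bar_coord k' : leader_mean U k' ord0 ^+ 2 <= C2 * c.
  by apply: le_trans (bound2 _ _) _; rewrite ler_pM2l.
case: (split_ordP j) => i ->.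
  have -> : U k (lshift n i) = leader_mean U (lshift _ k) ord0.
    rewrite /leader_mean col_mxEu !mxE ord1; congr (U _ _).
  apply: le_trans (bar_coord _) _; apply: ler_wpM2r => //; lra.
have -> : U k (rshift 1 i)
    = deviation i U k ord0 + leader_mean U (rshift _ k) ord0.
  rewrite /leader_mean col_mxEd.
  have -> : U k (rshift 1 i) = follower i U k ord0 by rewrite !mxE.
  by rewrite follower_deviation mxE.
have dev_coord : deviation i U k ord0 ^+ 2 <= n%:R * C1 * c.
  apply: le_trans (bound1 _ _) _; rewrite [n%:R * _]mulrC -mulrA.
  by rewrite ler_pM2l.
move: dev_coord (bar_coord (rshift lu k)).
move: (leader_mean U _ _) (deviation i U _ _) => x y.
move: (n%:R * C1) => C' *; have := sqr_ge0 (x - y); nra.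
Qed.

End NetworkGame.

(** * Expectation under independence *)

Section Independence.
Context {R : realType} {d : measure_display} {Omega : measurableType d}.
Variable P : probability Omega R.

(** Independence says that the joint distribution is the product of the two
    distributions, and Fubini's theorem integrates the product of the
    coordinates. *)
Lemma expectationM_indep (X Y : {RV P >-> R}) :
  (X : Omega -> R) \in Lfun P 2%:E -> (Y : Omega -> R) \in Lfun P 2%:E ->
  (forall A B, measurable A -> measurable B ->
     P (X @^-1` A `&` Y @^-1` B) = (P (X @^-1` A) * P (Y @^-1` B))%E) ->
  ('E_P[X \* Y] = 'E_P[X] * 'E_P[Y])%E.
Proof.
move=> X2 Y2 indep.
have PT : P setT \is a fin_num by rewrite probability_setT.
have iX : P.-integrable setT (EFin \o X).
  by apply/Lfun1_integrable; exact: Lfun_subset12 X2.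
have iY : P.-integrable setT (EFin \o Y).
  by apply/Lfun1_integrable; exact: Lfun_subset12 Y2.
have iXY : P.-integrable setT (EFin \o (X \* Y)).
  by apply/Lfun1_integrable; exact: Lfun2_mul_Lfun1.
have mh : measurable_fun setT (fun o => (X o, Y o)).
  exact: measurable_fun_pair.
pose h : {mfun Omega >-> (R * R)%type} :=
  HB.pack (fun o => (X o, Y o)) (isMeasurableFun.Build _ _ _ _ _ mh).
pose m1 := distribution P X; pose m2 := distribution P Y.
have prodE A : measurable A -> (m1 \x m2)%E A = distribution P h A.
  apply: product_measure_unique => B C mB mC; exact: indep.
pose F (z : R * R) := (z.1 * z.2)%:E.
have mF : measurable_fun setT F.
  by apply/measurable_EFinP; apply: measurable_funM.
have iF : (m1 \x m2)%E.-integrable setT F.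
  apply/integrableP; split=> //.
  rewrite (eq_measure_integral (distribution P h)); last first.
    by move=> A mA _; exact: prodE.
  rewrite ge0_integral_distribution//; last exact: measurableT_comp.
  by have /integrableP[] := iXY.
rewrite unlock.
transitivity (\int[distribution P h]_z F z)%E.
  by rewrite integral_distribution.
rewrite [LHS](eq_measure_integral (m1 \x m2)%E); last first.
  by move=> A mA _; exact/esym/prodE.
rewrite -integral12_prod_meas1//.
have i1 : m1.-integrable setT (EFin : R -> \bar R).
  apply/integrableP; split=> //; rewrite ge0_integral_distribution//=.
    by have /integrableP[] := iX.
  exact: measurableT_comp.
have i2 : m2.-integrable setT (EFin : R -> \bar R).
  apply/integrableP; split=> //; rewrite ge0_integral_distribution//=.
    by have /integrableP[] := iY.
  exact: measurableT_comp.
have E1 : (\int[m1]_x x%:E = \int[P]_o (X o)%:E)%E.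
  by rewrite integral_distribution.
have E2 : (\int[m2]_x x%:E = \int[P]_o (Y o)%:E)%E.
  by rewrite integral_distribution.
have F2 : (\int[m2]_x x%:E)%E \is a fin_num by rewrite integrable_fin_num.
under eq_integral => x _.
  rewrite /fubini_F /F /=; under eq_integral do rewrite EFinM.
  rewrite integralZl// -(fineK F2).
  over.
by rewrite integralZr// fineK// E1 E2.
Qed.

(** Dynkin's theorem: independence from a set extends from a pi-system to the
    sigma-algebra that it generates. *)
Lemma indep_sigma (G : set (set Omega)) (B : set Omega) :
  G `<=` measurable -> setI_closed G -> G setT -> measurable B ->
  (forall A, G A -> P (A `&` B) = (P A * P B)%E) ->
  forall A, <<s G >> A -> P (A `&` B) = (P A * P B)%E.
Proof.
move=> mG IG GT mB indep A sA.
have pB : (0 <= fine (P B))%R by rewrite fine_ge0.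
have PB : P B = (fine (P B))%:E by rewrite fineK// fin_num_measure.
have mE C : mscale (NngNum pB) P C = (P C * P B)%E.
  by rewrite /mscale/= PB muleC.
rewrite -mE; apply: (@g_sigma_algebra_measure_unique _ _ _ G mG (fun=> setT)
  (fun=> GT) _ (mrestr P mB) (mscale (NngNum pB) P) IG) => //.
- by rewrite bigcup_const//; exists 0%N.
- by move=> C GC; rewrite [RHS]mE; exact: indep.
- move=> _; rewrite /= /mrestr (le_lt_trans (probability_le1 _ _)) ?ltry//.
  by rewrite setTI.
Qed.

End Independence.

(** * Linear conditions on random matrices *)

Section LinearClasses.
Context {R : realType} {T : Type}.
Variable C : (T -> R) -> Prop.

(** Square integrability, measurability, orthogonality to a random variable and
    centredness are linear conditions. The entrywise versions of all of them
    are therefore preserved by the linear maps of the network. *)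
Definition linear_class := C (fun=> 0) /\
  forall a f g, C f -> C g -> C (fun x => a * f x + g x).

Definition entries_in m n (f : T -> 'M[R]_(m, n)) :=
  forall i j, C (fun x => f x i j).

Hypothesis linC : linear_class.

Lemma classD f g : C f -> C g -> C (fun x => f x + g x).
Proof.
move=> Cf Cg; have := linC.2 1 f g Cf Cg.
by congr C; apply/funext => x; rewrite mul1r.
Qed.

Lemma classZ a f : C f -> C (fun x => a * f x).
Proof.
move=> Cf; have := linC.2 a f _ Cf linC.1.
by congr C; apply/funext => x; rewrite addr0.
Qed.

Lemma class_sum (I : Type) (r : seq I) (Q : pred I) (F : I -> T -> R) :
  (forall i, Q i -> C (F i)) -> C (fun x => \sum_(i <- r | Q i) F i x).
Proof.
move=> CF; elim: r => [|i r IHr].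
  by have := linC.1; congr C; apply/funext => x; rewrite big_nil.
have [Qi|nQi] := boolP (Q i).
  have := classD (CF i Qi) IHr.
  by congr C; apply/funext => x; rewrite big_cons Qi.
by move: IHr; congr C; apply/funext => x; rewrite big_cons (negbTE nQi).
Qed.

Lemma entries_linear m n p q (L : {linear 'M[R]_(m, n) -> 'M[R]_(p, q)}) f :
  entries_in f -> entries_in (fun x => L (f x)).
Proof.
move=> Cf i j.
have : C (fun x => \sum_k \sum_l L (delta_mx k l) i j * f x k l).
  apply: class_sum => k _; apply: class_sum => l _; exact: classZ.
congr C; apply/funext => x; rewrite [in RHS](matrix_sum_delta (f x)).
rewrite !linear_sum summxE; apply: eq_bigr => k _.
rewrite linear_sum summxE; apply: eq_bigr => l _.
by rewrite linearZ mxE mulrC.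
Qed.

Lemma entriesD m n (f g : T -> 'M[R]_(m, n)) :
  entries_in f -> entries_in g -> entries_in (fun x => f x + g x).
Proof.
move=> Cf Cg i j; have := classD (Cf i j) (Cg i j).
by congr C; apply/funext => x; rewrite mxE.
Qed.

Lemma entriesN m n (f : T -> 'M[R]_(m, n)) :
  entries_in f -> entries_in (fun x => - f x).
Proof.
move=> Cf i j; have := classZ (-1) (Cf i j).
by congr C; apply/funext => x; rewrite mxE mulN1r.
Qed.

Lemma entriesB m n (f g : T -> 'M[R]_(m, n)) :
  entries_in f -> entries_in g -> entries_in (fun x => f x - g x).
Proof. by move=> Cf Cg; apply: entriesD => //; exact: entriesN. Qed.

Lemma entries0 m n : entries_in (fun=> 0 : 'M[R]_(m, n)).
Proof.
by move=> i j; have := linC.1; congr C; apply/funext => x; rewrite mxE.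
Qed.

Lemma entries_mulmx m n p (A : 'M[R]_(p, m)) (f : T -> 'M[R]_(m, n)) :
  entries_in f -> entries_in (fun x => A *m f x).
Proof. exact: (entries_linear (mulmx A)). Qed.

Lemma entries_col_mx m1 m2 n (f : T -> 'M[R]_(m1, n)) (g : T -> 'M[R]_(m2, n)) :
  entries_in f -> entries_in g -> entries_in (fun x => col_mx (f x) (g x)).
Proof.
move=> Cf Cg i j; case: (split_ordP i) => k ->.
  by have := Cf k j; congr C; apply/funext => x; rewrite col_mxEu.
by have := Cg k j; congr C; apply/funext => x; rewrite col_mxEd.
Qed.

Lemma entries_usubmx m1 m2 n (f : T -> 'M[R]_(m1 + m2, n)) :
  entries_in f -> entries_in (fun x => usubmx (f x)).
Proof. exact: (entries_linear usubmx). Qed.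

Lemma entries_dsubmx m1 m2 n (f : T -> 'M[R]_(m1 + m2, n)) :
  entries_in f -> entries_in (fun x => dsubmx (f x)).
Proof. exact: (entries_linear dsubmx). Qed.

End LinearClasses.

(** * Measurability of matrix-valued functions *)

Section MatrixMeasurability.
Context {R : realType}.

Definition measurable_entries d (T : measurableType d) m n
  (f : T -> 'M[R]_(m, n)) := entries_in (measurable_fun [set: T]) f.

Lemma measurable_linear_class d (T : measurableType d) :
  linear_class (fun f : T -> R => measurable_fun [set: T] f).
Proof.
split=> [|a f g mf mg]; first exact: measurable_cst.
by apply: measurable_funD => //; apply: measurable_funM.
Qed.

Lemma measurable_coord m n i j :
  measurable_fun [set: @Rmx R m n]
    (fun X : @Rmx R m n => (X : 'M[R]_(m, n)) i j).
Proof.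
move=> _ U mU; rewrite setTI; apply: sub_sigma_algebra.
by exists i, j, U.
Qed.

Lemma measurable_entriesP d (T : measurableType d) m n (f : T -> 'M[R]_(m, n)) :
  measurable_fun [set: T] (f : T -> @Rmx R m n) <-> measurable_entries f.
Proof.
split=> [mf i j|mf].
  exact: (measurableT_comp (measurable_coord i j) mf).
apply: (@measurability _ _ T (@Rmx R m n) setT f (@mx_cylinders R m n)) => //.
move=> _ [_ [i [j [U [mU ->]]]] <-].
exact: mf.
Qed.

Lemma measurable_entries_comp d (T : measurableType d) m n p q
    (h : 'M[R]_(m, n) -> 'M[R]_(p, q)) (f : T -> 'M[R]_(m, n)) :
  mx_measurable h -> measurable_entries f ->
  measurable_entries (fun x => h (f x)).
Proof.
move=> mh /measurable_entriesP mf; apply/measurable_entriesP.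
exact: (measurableT_comp mh mf).
Qed.

Lemma mx_measurableP m n p q (h : 'M[R]_(m, n) -> 'M[R]_(p, q)) :
  (forall d (T : measurableType d) (f : T -> 'M[R]_(m, n)),
     measurable_entries f -> measurable_entries (fun x => h (f x))) ->
  mx_measurable h.
Proof.
move=> mh; apply/measurable_entriesP.
by apply: (mh _ (@Rmx R m n) id) => i j; exact: measurable_coord.
Qed.

Lemma measurable_entries_cst d (T : measurableType d) m n (A : 'M[R]_(m, n)) :
  measurable_entries (fun _ : T => A).
Proof. by move=> i j; exact: measurable_cst. Qed.

End MatrixMeasurability.

(** * Independent families of random matrices *)

Section IndependentFamily.
Context {R : realType} {d : measure_display} {Omega : measurableType d}.
Variable P : probability Omega R.
Variables (m n : nat) (I : finType) (X : I -> Omega -> 'M[R]_(m, n)).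
Hypothesis mX : forall i, measurable_entries (X i).
Hypothesis indepX : mutually_independent P X.

(** The cylinders that generate the information carried by the members of the
    family with index in [J]; they form a pi-system. *)
Definition events (J : {set I}) : set (set Omega) :=
  [set A | exists U : I -> set (@Rmx R m n), (forall i, measurable (U i)) /\
     A = \bigcap_(i in [set` J]) (X i @^-1` U i)].

Lemma measurable_preimage i (V : set (@Rmx R m n)) :
  measurable V -> measurable (X i @^-1` V).
Proof.
by move=> mV; rewrite -[_ @^-1` _]setTI; apply: (measurable_entriesP _).2.
Qed.

Lemma events_measurable J : events J `<=` measurable.
Proof.
move=> _ [U [mU ->]]; apply: fin_bigcap_measurable => [|i _].
  exact: finite_finset.
exact: measurable_preimage.
Qed.

Lemma eventsT J : events J setT.
Proof.
exists (fun=> setT); split=> // ; apply/esym/seteqP; split=> // x _ i _.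
Qed.

Lemma eventsI J : setI_closed (events J).
Proof.
move=> _ _ [U [mU ->]] [V [mV ->]]; exists (fun i => U i `&` V i); split.
  by move=> i; exact: measurableI.
by rewrite -bigcapI; apply: eq_bigcapr => i _; rewrite preimage_setI.
Qed.

Lemma events_coord (J : {set I}) i k l : i \in J ->
  measurable_fun [set: g_sigma_algebraType (events J)]
    (fun o : g_sigma_algebraType (events J) => X i o k l).
Proof.
move=> iJ _ V mV; rewrite setTI; apply: sub_sigma_algebra.
exists (fun j =>
  if j == i then (fun M : 'M[R]_(m, n) => M k l) @^-1` V else setT).
split=> [j|]; first case: ifP => _ //.
  by have := measurable_coord (R:=R) k l measurableT mV; rewrite setTI.
apply/seteqP; split=> [y Vo j _|o /(_ i iJ)]; last by rewrite /= eqxx.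
by rewrite /=; case: eqP => // ->.
Qed.

Lemma indep_events (J : {set I}) i (V : set (@Rmx R m n)) :
  i \notin J -> measurable V ->
  forall A, <<s events J >> A ->
  P (A `&` X i @^-1` V) = (P A * P (X i @^-1` V))%E.
Proof.
move=> iJ mV; apply: indep_sigma; [exact: events_measurable|exact: eventsI|
  exact: eventsT|exact: measurable_preimage|] => _ [U [mU ->]].
pose U' j := if j == i then V else U j.
have mU' j : measurable (U' j) by rewrite /U'; case: ifP.
have capE : \bigcap_(j in [set` (i |: J)]) (X j @^-1` U' j)
    = \bigcap_(j in [set` J]) (X j @^-1` U j) `&` X i @^-1` V.
  apply/seteqP; split=> [y Uo|o [UJ Vi] j /=].
    split=> [j jJ|]; last first.
      by have := Uo i; rewrite /= setU11 /U' eqxx; apply.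
    have := Uo j; rewrite /= setU1r// /U'; case: eqP => [ji|_]; last exact.
    by move: jJ; rewrite /= ji (negbTE iJ).
  rewrite in_setU1 /U'; case: eqP => [->//|_ /= jJ]; exact: UJ.
have fin A : measurable A -> P A \is a fin_num.
  by move=> *; exact: fin_num_measure.
have mcap : measurable (\bigcap_(j in [set` J]) (X j @^-1` U j)).
  by apply: (@events_measurable J); exists U.
have mi := measurable_preimage i mV.
have := indepX (i |: J) mU'; rewrite capE big_setU1//= {1}/U' eqxx.
rewrite (eq_bigr (fun j => fine (P (X j @^-1` U j)))); last first.
  move=> j jJ; rewrite /U'; case: eqP => // ji.
  by move: jJ; rewrite ji (negbTE iJ).
rewrite -indepX// mulrC => eqP.
rewrite -[LHS]fineK ?fin//; last exact: measurableI.
by rewrite eqP EFinM !fineK ?fin.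
Qed.

Lemma expectation_events (J : {set I}) i k l (f : Omega -> R) : i \notin J ->
  measurable_fun [set: g_sigma_algebraType (events J)]
    (f : g_sigma_algebraType (events J) -> R) ->
  f \in Lfun P 2%:E -> (fun o => X i o k l) \in Lfun P 2%:E ->
  ('E_P[fun o => X i o k l] = 0)%E ->
  ('E_P[fun o => (f o * X i o k l)%R] = 0)%E.
Proof.
move=> iJ mf f2 X2 X0.
have mf' : measurable_fun setT f by case/andP: (f2); rewrite inE.
pose F : {mfun Omega >-> R} := HB.pack f (isMeasurableFun.Build _ _ _ _ _ mf').
pose Y : {mfun Omega >-> R} := HB.pack (fun o => X i o k l)
  (isMeasurableFun.Build _ _ _ _ _ (mX i k l)).
rewrite (expectationM_indep (X := F) (Y := Y))// ?X0 ?mule0// => A B mA mB.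
have := indep_events iJ (V := (fun M : 'M[R]_(m, n) => M k l) @^-1` B).
apply; last by have := mf measurableT _ mA; rewrite setTI.
by have := measurable_coord (R:=R) k l measurableT mB; rewrite setTI.
Qed.

End IndependentFamily.

(** * Linear conditions along the network *)

Section AgentEntries.
Context {R : realType} {T : Type} {n : nat}.
Variable C : (T -> R) -> Prop.
Hypothesis linC : linear_class C.

Lemma entries_leader l (f : T -> 'M[R]_(l, 1 + n)) :
  entries_in C f -> entries_in C (fun x => leader (f x)).
Proof. exact: (entries_linear linC leader). Qed.

Lemma entries_follower l i (f : T -> 'M[R]_(l, 1 + n)) :
  entries_in C f -> entries_in C (fun x => follower i (f x)).
Proof. exact: (entries_linear linC (follower i)). Qed.

Lemma entries_mean l (f : T -> 'M[R]_(l, 1 + n)) :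
  entries_in C f -> entries_in C (fun x => mean (f x)).
Proof. exact: (entries_linear linC mean). Qed.

Lemma entries_deviation l i (f : T -> 'M[R]_(l, 1 + n)) :
  entries_in C f -> entries_in C (fun x => deviation i (f x)).
Proof. exact: (entries_linear linC (deviation i)). Qed.

Lemma entries_leader_mean l (f : T -> 'M[R]_(l, 1 + n)) :
  entries_in C f -> entries_in C (fun x => leader_mean (f x)).
Proof. exact: (entries_linear linC leader_mean). Qed.

Lemma entries_joint l (f0 : T -> 'cV[R]_l) (f : 'I_n -> T -> 'cV[R]_l) :
  entries_in C f0 -> (forall i, entries_in C (f i)) ->
  entries_in C (fun x => joint (f0 x) (fun i => f i x)).
Proof.
move=> Cf0 Cf k j; case: (split_ordP j) => i ->.
  have := Cf0 k i; congr C; apply/funext => x.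
  by rewrite /joint row_mxEl.
have := Cf i k ord0; congr C; apply/funext => x.
by rewrite /joint row_mxEr mxE.
Qed.

Lemma entries_assemble l (z : T -> 'cV[R]_(l + l)) (f : 'I_n -> T -> 'cV[R]_l) :
  entries_in C z -> (forall i, entries_in C (f i)) ->
  entries_in C (fun x => assemble (z x) (fun i => f i x)).
Proof.
move=> Cz Cf; apply: entries_joint => [|i]; first exact: entries_usubmx.
by apply: entriesD => //; exact: entries_dsubmx.
Qed.

Context {lx lu : nat}.
Variables (N : network R lx lu) (gam : R) (H : nat).

Lemma entries_dynamics t (X D W : T -> 'M[R]_(lx, 1 + n))
    (U : T -> 'M[R]_(lu, 1 + n)) :
  entries_in C X -> entries_in C U -> entries_in C D -> entries_in C W ->
  entries_in C (fun x => dynamics N t (X x) (U x) (D x) (W x)).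
Proof.
move=> CX CU CD CW; apply: entries_joint => [|i];
  do 4?[apply: entriesD => //]; do 1?[apply: entriesD => //];
  do ?[apply: entries_mulmx => //];
  by [exact: entries_leader | exact: entries_follower | exact: entries_mean].
Qed.

Lemma entries_saddle_action t (X : T -> 'M[R]_(lx, 1 + n)) :
  entries_in C X -> entries_in C (fun x => saddle_action N gam H t (X x)).
Proof.
move=> CX; apply: entries_assemble => [|i]; apply: entries_mulmx => //.
  exact: entries_leader_mean.
exact: entries_deviation.
Qed.

Lemma entries_saddle_disturbance t (X : T -> 'M[R]_(lx, 1 + n)) :
  entries_in C X -> entries_in C (fun x => saddle_disturbance N gam H t (X x)).
Proof.
move=> CX; apply: entries_assemble => [|i]; apply: entries_mulmx => //.
  exact: entries_leader_mean.
exact: entries_deviation.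
Qed.

End AgentEntries.

(** * First and second moments *)

Section Moments.
Context {R : realType} {d : measure_display} {Omega : measurableType d}.
Variable P : probability Omega R.

Notation L1 f := (f \in Lfun P 1).
Notation L2 f := (f \in Lfun P 2%:E).

Definition mean_value (f : Omega -> R) : R := fine ('E_P[f])%E.
Notation "''E' f" := (mean_value f) (at level 10, f at level 8).

Lemma Lfun_linear_class (p : \bar R) : (1 <= p)%E ->
  linear_class (fun f : Omega -> R => f \in Lfun P p).
Proof.
move=> p1; have [L0 LS] := Lfun_submod_closed P p1.
by split=> // a f g; exact: LS.
Qed.

Lemma L1_linear_class : linear_class (fun f : Omega -> R => L1 f).
Proof. exact: Lfun_linear_class. Qed.

Lemma L2_linear_class : linear_class (fun f : Omega -> R => L2 f).
Proof. by apply: Lfun_linear_class; rewrite lee1n. Qed.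

Lemma L2_L1 f : L2 f -> L1 f.
Proof. by apply: Lfun_subset12; exact: fin_num_measure. Qed.

Lemma L2_mul f g : L2 f -> L2 g -> L1 (fun o => f o * g o).
Proof. exact: Lfun2_mul_Lfun1. Qed.

Lemma L2_cst c : L2 (fun _ : Omega => c).
Proof. exact: Lfun_cst. Qed.

Lemma L2_measurable f : L2 f -> measurable_fun setT f.
Proof. by case/andP; rewrite inE. Qed.

Lemma mean_valueK f : L1 f -> ('E_P[f] = ('E f)%:E)%E.
Proof. by move=> ?; rewrite fineK// expectation_fin_num. Qed.

Lemma mean_value_lin a f g : L1 f -> L1 g ->
  'E (fun o => a * f o + g o) = a * 'E f + 'E g.
Proof.
move=> f1 g1; have af1 : L1 (fun o => a * f o).
  by apply: (classZ L1_linear_class).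
have := expectationD af1 g1; have := expectationZl a f1.
have -> : (a \o* f) = (fun o => a * f o) by apply/funext => o; rewrite /= mulrC.
move=> Ea Eg; rewrite /mean_value.
rewrite [X in fine X](_ : _ = (a * 'E f + 'E g)%:E)//.
by rewrite [LHS]Eg Ea !mean_valueK.
Qed.

Lemma mean_value0 : 'E (fun=> 0) = 0.
Proof. by rewrite /mean_value expectation_cst. Qed.

Lemma mean_valueD f g : L1 f -> L1 g -> 'E (fun o => f o + g o) = 'E f + 'E g.
Proof.
move=> f1 g1; rewrite -[in RHS](mul1r ('E f)) -mean_value_lin//.
by congr mean_value; apply/funext => o; rewrite mul1r.
Qed.

Lemma mean_valueZ a f : L1 f -> 'E (fun o => a * f o) = a * 'E f.
Proof.
move=> f1; rewrite -[RHS]addr0 -mean_value0 -mean_value_lin//; last first.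
  exact: L1_linear_class.1.
by congr mean_value; apply/funext => o; rewrite addr0.
Qed.

Lemma mean_value_sum (I : eqType) (r : seq I) (Q : pred I)
    (F : I -> Omega -> R) :
  (forall i, i \in r -> Q i -> L1 (F i)) ->
  'E (fun o => \sum_(i <- r | Q i) F i o) = \sum_(i <- r | Q i) 'E (F i) /\
  L1 (fun o => \sum_(i <- r | Q i) F i o).
Proof.
elim: r => [|i r IHr] F1.
  have -> : (fun o => \sum_(i <- [::] | Q i) F i o) = fun=> 0.
    by apply/funext => o; rewrite big_nil.
  by rewrite big_nil mean_value0; split=> //; exact: L1_linear_class.1.
have [j jr|Er Lr] := IHr; first by apply: F1; rewrite inE jr orbT.
rewrite big_cons; case: ifP => Qi; last first.
  by under eq_fun do rewrite big_cons Qi.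
under eq_fun do rewrite big_cons Qi.
have Li : L1 (F i) by apply: F1; rewrite // mem_head.
by rewrite mean_valueD// Er; split=> //; apply: (classD L1_linear_class).
Qed.

Lemma mean_value_ge0 f : (forall o, 0 <= f o) -> 0 <= 'E f.
Proof. by move=> f0; rewrite fine_ge0// expectation_ge0. Qed.

Lemma mean_value_le0 f : (forall o, f o <= 0) -> 'E f <= 0.
Proof.
move=> f0; rewrite fine_le0// unlock.
rewrite (eq_integral (fun o => - (- f o)%:E)%E) => [|o _]; last first.
  by rewrite EFinN oppeK.
rewrite integral_ge0N => [|o _]; last by rewrite lee_fin oppr_ge0.
by rewrite oppe_le0 integral_ge0// => o _; rewrite lee_fin oppr_ge0.
Qed.

Notation sq X := (entries_in (fun f : Omega -> R => L2 f) X).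

Lemma L1_dot l (X Y : Omega -> 'cV[R]_l) : sq X -> sq Y ->
  L1 (fun o => dot (X o) (Y o)).
Proof.
move=> X2 Y2; have : L1 (fun o => \sum_k X o k ord0 * Y o k ord0).
  by apply: (class_sum L1_linear_class) => k _; exact: L2_mul.
by congr (L1 _); apply/funext => o; rewrite dotE.
Qed.

Lemma L1_quad l (A : 'M[R]_l) (X : Omega -> 'cV[R]_l) : sq X ->
  L1 (fun o => quad A (X o)).
Proof.
move=> X2; under eq_fun do rewrite quadE; apply: L1_dot => //.
exact: (entries_mulmx L2_linear_class).
Qed.

Definition L2_orthogonal (f g : Omega -> R) : Prop :=
  L2 f /\ L2 g /\ 'E (fun o => f o * g o) = 0.

Lemma L2_orthogonal_classr f : L2 f -> linear_class (L2_orthogonal f).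
Proof.
move=> f2; split=> [|a g h [_ [g2 Eg]] [_ [h2 Eh]]].
  split=> //; split; first exact: L2_linear_class.1.
  by under eq_fun do rewrite mulr0; exact: mean_value0.
split=> //; split; first exact: L2_linear_class.2.
rewrite (_ : (fun o => _) = (fun o => a * (f o * g o) + f o * h o)).
  by rewrite mean_value_lin ?Eg ?Eh ?mulr0 ?addr0//; exact: L2_mul.
by apply/funext => o; ring.
Qed.

Lemma L2_orthogonalC f g : L2_orthogonal f g -> L2_orthogonal g f.
Proof.
move=> [f2 [g2 E0]]; split=> //; split=> //; rewrite -[RHS]E0.
by congr mean_value; apply/funext => o; rewrite mulrC.
Qed.

Lemma L2_orthogonal_classl g : L2 g -> linear_class (L2_orthogonal^~ g).
Proof.
move=> g2; have [g0 gS] := L2_orthogonal_classr g2; split.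
  exact: L2_orthogonalC.
by move=> a f h /L2_orthogonalC fg /L2_orthogonalC hg; apply/L2_orthogonalC/gS.
Qed.

Lemma L2_orthogonal_dot l (X Y : Omega -> 'cV[R]_l) :
  (forall i j, L2_orthogonal (fun o => X o i ord0) (fun o => Y o j ord0)) ->
  'E (fun o => dot (X o) (Y o)) = 0.
Proof.
move=> XY; have [|EXY _] := @mean_value_sum _ (index_enum _) xpredT
    (fun k o => X o k ord0 * Y o k ord0).
  by move=> k _ _; have [? [? _]] := XY k k; exact: L2_mul.
under eq_fun do rewrite dotE.
by rewrite EXY big1// => k _; have [_ [_]] := XY k k.
Qed.

Lemma L2_orthogonal_linear m n p q m' n' p' q'
    (L : {linear 'M[R]_(m, n) -> 'M[R]_(p, q)})
    (L' : {linear 'M[R]_(m', n') -> 'M[R]_(p', q')})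
    (X : Omega -> 'M[R]_(m, n)) (Y : Omega -> 'M[R]_(m', n')) :
  sq X -> sq Y ->
  (forall i j k l, L2_orthogonal (fun o => X o i j) (fun o => Y o k l)) ->
  forall i j k l, L2_orthogonal (fun o => L (X o) i j) (fun o => L' (Y o) k l).
Proof.
move=> X2 Y2 XY i j k l.
have LX2 : sq (fun o => L (X o)) by exact: (entries_linear L2_linear_class).
apply: (entries_linear (L2_orthogonal_classr (LX2 i j))) => k' l'.
by apply: (entries_linear (L2_orthogonal_classl (Y2 k' l'))) => i' j'.
Qed.

Definition zero_mean (f : Omega -> R) : Prop := L2 f /\ ('E_P[f] = 0)%E.

Lemma zero_mean_class : linear_class zero_mean.
Proof.
split=> [|a f g [f2 f0] [g2 g0]].
  by split; [exact: L2_linear_class.1|exact: expectation_cst].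
split; first exact: L2_linear_class.2.
have fg1 : L1 (fun o => a * f o + g o).
  by apply: L1_linear_class.2; exact: L2_L1.
rewrite mean_valueK// mean_value_lin; try exact: L2_L1.
by rewrite /mean_value f0 g0 /= mulr0 addr0.
Qed.

(** For a centred vector the covariance is the matrix of second moments. *)
Lemma mean_value_quad l (A : 'M[R]_l) (v : Omega -> 'cV[R]_l) :
  entries_in zero_mean v -> 'E (fun o => quad A (v o)) = \tr (A *m Cov P v).
Proof.
move=> v0; have v2 i : L2 (fun o => v o i ord0) by have [] := v0 i ord0.
have vv1 i j : L1 (fun o => v o i ord0 * v o j ord0) by exact: L2_mul.
have covE i j : Cov P v j i = 'E (fun o => v o i ord0 * v o j ord0).
  rewrite mxE covarianceC covarianceE.
  - rewrite (v0 i ord0).2 (v0 j ord0).2 mule0 oppe0 adde0.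
    by [].
  - exact: L2_L1.
  - exact: L2_L1.
  - exact: vv1.
pose F i j o := A i j * (v o i ord0 * v o j ord0).
have F1 i j : L1 (F i j) by apply: (classZ L1_linear_class).
have quadF o : quad A (v o) = \sum_i \sum_j F i j o.
  rewrite quadE dotE; apply: eq_bigr => i _; rewrite mxE mulr_sumr.
  by apply: eq_bigr => j _; rewrite /F; ring.
under eq_fun do rewrite quadF.
have S1 i : 'E (fun o => \sum_j F i j o) = \sum_j 'E (F i j) /\
    L1 (fun o => \sum_j F i j o).
  by apply: mean_value_sum.
rewrite (mean_value_sum (F := fun i o => \sum_j F i j o) _).1; last first.
  by move=> i _ _; case: (S1 i).
rewrite /mxtrace; apply: eq_bigr => i _; rewrite (S1 i).1 mxE.
by apply: eq_bigr => j _; rewrite mean_valueZ// covE.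
Qed.

End Moments.

(** * The saddle-point laws *)

Section SaddleStrategy.
Context {R : realType} {n lx lu : nat}.
Variables (N : network R lx lu) (gam : R) (T : nat).

Definition saddle_strategy : strategy R n lx lu :=
  Strategy
    (fun t z => usubmx (barL N gam T t *m z))
    (fun t _ z => let xi := usubmx z in
                  let xbar := usubmx (dsubmx z) in
                  let x0 := dsubmx (dsubmx z) in
                  breveL N gam T t *m (xi - xbar)
                    + dsubmx (barL N gam T t *m col_mx x0 xbar)).

Lemma saddle_strategy_actions t X :
  actions saddle_strategy t X = saddle_action N gam T t X.
Proof.
rewrite /actions /saddle_action /assemble /leader_action /follower_action /=.
congr joint; apply/funext => i.
by rewrite !col_mxKd !col_mxKu.
Qed.

Lemma measurable_saddle_strategy : measurable_strategy saddle_strategy.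
Proof.
split=> [t|t i]; apply: mx_measurableP => d S f mf;
  have lin := measurable_linear_class (R := R) S.
  by apply: (entries_usubmx lin); apply: entries_mulmx.
have md := entries_dsubmx lin mf.
apply: (entriesD lin); first apply: (entries_mulmx lin).
  apply: (entriesB lin); first exact: (entries_usubmx lin mf).
  exact: (entries_usubmx lin md).
apply: (entries_dsubmx lin); apply: (entries_mulmx lin); apply: entries_col_mx.
  exact: (entries_dsubmx lin md).
exact: (entries_usubmx lin md).
Qed.

Lemma measurable_saddle_disturbance t :
  mx_measurable (saddle_disturbance (n := n) N gam T t).
Proof.
apply: mx_measurableP => d S f mf.
exact: (entries_saddle_disturbance (measurable_linear_class (R := R) S)).
Qed.

End SaddleStrategy.

(** * Plays of the game *)

Section Plays.
Context {R : realType} {n lx lu : nat}.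
Variables (N : network R lx lu) (gam : R) (T : nat).

Lemma measurable_actions (g : strategy R n lx lu) t d (S : measurableType d)
    (X : S -> 'M[R]_(lx, 1 + n)) :
  measurable_strategy g -> measurable_entries X ->
  measurable_entries (fun o => actions g t (X o)).
Proof.
move=> [ml mf] mX; have lin := measurable_linear_class (R := R) S.
apply: entries_joint => [|i].
  apply: (measurable_entries_comp (ml t)); apply: entries_col_mx.
    exact: (entries_leader lin mX).
  exact: (entries_mean lin mX).
apply: (measurable_entries_comp (mf t i)); apply: entries_col_mx.
  exact: (entries_follower lin i mX).
apply: entries_col_mx; first exact: (entries_mean lin mX).
exact: (entries_leader lin mX).
Qed.

Lemma stateE d (S : measurableType d) (w : nat -> S -> 'M[R]_(lx, 1 + n)) s xi
    (g : strategy R n lx lu) dl o : state N w s xi g dl s o = xi o.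
Proof. by rewrite /state subnn. Qed.

Lemma stateS d (S : measurableType d) (w : nat -> S -> 'M[R]_(lx, 1 + n)) s xi
    (g : strategy R n lx lu) dl t o : (s <= t)%N ->
  let X := state N w s xi g dl t o in
  state N w s xi g dl t.+1 o = dynamics N t X (actions g t X) (dl t X) (w t o).
Proof. by move=> st; rewrite /state subSn//= subnKC. Qed.

Lemma state_ind (Q : nat -> Prop) s m : Q s ->
  (forall t, (s <= t < m)%N -> Q t -> Q t.+1) ->
  forall t, (s <= t <= m)%N -> Q t.
Proof.
move=> Qs QS; elim=> [|t IHt] /andP[st tm].
  by move: st Qs; rewrite leqn0 => /eqP->.
move: st; rewrite leq_eqVlt => /orP[/eqP<-//|]; rewrite ltnS => st.
by apply: QS; rewrite ?st//; apply: IHt; rewrite st ltnW.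
Qed.

Lemma measurable_state d (S : measurableType d)
    (w : nat -> S -> 'M[R]_(lx, 1 + n)) s xi (g : strategy R n lx lu) dl m :
  measurable_strategy g -> (forall t, mx_measurable (dl t)) ->
  measurable_entries xi ->
  (forall t, (s <= t < m)%N -> measurable_entries (w t)) ->
  forall t, (s <= t <= m)%N -> measurable_entries (state N w s xi g dl t).
Proof.
move=> mg mdl mxi mw; apply: state_ind => [|t tm mX].
  by move=> i j; under eq_fun do rewrite stateE; exact: mxi.
have := entries_dynamics (measurable_linear_class (R := R) S) N t mX
  (measurable_actions t mg mX) (measurable_entries_comp (mdl t) mX) (mw t tm).
move=> mS i j; have := mS i j; congr measurable_fun; apply/funext => o.
by rewrite stateS//; case/andP: tm.
Qed.

(** Compares plays whose laws differ from some time on, such as those where the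
    disturbance is switched off. *)
Lemma eq_state d (S : measurableType d) (w : nat -> S -> 'M[R]_(lx, 1 + n)) s xi
    (g g' : strategy R n lx lu) dl dl' m :
  (forall t X, (s <= t < m)%N ->
     actions g t X = actions g' t X /\ dl t X = dl' t X) ->
  forall t, (s <= t <= m)%N ->
  state N w s xi g dl t = state N w s xi g' dl' t.
Proof.
move=> eq_laws; apply: state_ind => [|t tm IHt]; apply/funext => o.
  by rewrite !stateE.
have [st _] := andP tm.
rewrite !stateS// IHt.
by have [-> ->] := eq_laws t (state N w s xi g' dl' t o) tm.
Qed.

Lemma measurable_quad d (S : measurableType d) l (A : 'M[R]_l)
    (X : S -> 'cV[R]_l) :
  measurable_entries X -> measurable_fun setT (fun o => quad A (X o)).
Proof.
move=> mX; have lin := measurable_linear_class (R := R) S.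
under eq_fun do rewrite quadE dotE.
apply: (class_sum lin) => k _; apply: measurable_funM => //.
exact: (entries_mulmx lin).
Qed.

Lemma measurable_energy d (S : measurableType d) l (D : S -> 'M[R]_(l, 1 + n)) :
  measurable_entries D -> measurable_fun setT (fun o => energy (D o)).
Proof.
move=> mD; have lin := measurable_linear_class (R := R) S.
rewrite /energy; under eq_fun do under eq_bigr do rewrite sqnorm_quad.
under eq_fun do rewrite sqnorm_quad.
apply: (classD lin); last exact: (measurable_quad _ (entries_leader lin mD)).
apply/(classZ lin)/(class_sum lin) => i _.
exact: (measurable_quad _ (entries_follower lin i mD)).
Qed.

Hypothesis n_gt0 : (0 < n)%N.

Lemma measurable_stage_cost d (S : measurableType d) t
    (X D : S -> 'M[R]_(lx, 1 + n)) (U : S -> 'M[R]_(lu, 1 + n)) :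
  measurable_entries X -> measurable_entries U -> measurable_entries D ->
  measurable_fun setT (fun o => stage_cost N gam t (X o) (U o) (D o)).
Proof.
move=> mX mU mD; have lin := measurable_linear_class (R := R) S.
under eq_fun do rewrite stage_cost_energy//.
apply: measurable_funB; last exact/(classZ lin)/(measurable_energy mD).
apply: (classD lin).
  apply: (classD lin); last first.
    exact: (measurable_quad _ (entries_leader_mean lin mX)).
  apply/(classZ lin)/(class_sum lin) => i _; apply: (classD lin).
    exact: (measurable_quad _ (entries_deviation lin i mX)).
  exact: (measurable_quad _ (entries_deviation lin i mU)).
exact: (measurable_quad _ (entries_leader_mean lin mU)).
Qed.

Hypothesis cost_pos : forall t, (1 <= t <= T)%N ->
  [/\ possemidef (mQ N t), possemidef (barQ N t),
      posdef (mR N t) & posdef (barR N t)].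
Hypothesis gam_gt0 : 0 < gam.
Hypothesis gam_pos : forall t, (1 <= t <= T - 1)%N ->
  posdef ((gam ^+ 2)%:M - breveM N gam T t.+1) /\
  posdef ((gam ^+ 2)%:M - barM N gam T t.+1).

(** The value telescopes along every play; what remains is the noise, which
    enters through the value of the noise and a bilinear term, and the surplus
    due to the deviations from the saddle-point laws. *)
Lemma play_cost s (X : nat -> 'M[R]_(lx, 1 + n)) (U : nat -> 'M[R]_(lu, 1 + n))
    (D W : nat -> 'M[R]_(lx, 1 + n)) :
  (1 <= s <= T.+1)%N ->
  (forall t, (s <= t <= T)%N ->
     X t.+1 = dynamics N t (X t) (U t) (D t) (W t)) ->
  \sum_(s <= t < T.+1) stage_cost N gam t (X t) (U t) (D t)
  = value N gam T s (X s) + \sum_(s <= t < T.+1)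
     (value N gam T t.+1 (W t)
      + 2 * value_form N gam T t.+1 (dynamics N t (X t) (U t) (D t) 0) (W t)
      + game_surplus N gam T t (U t - saddle_action N gam T t (X t))
                               (D t - saddle_disturbance N gam T t (X t))).
Proof.
move=> /andP[s1 sT] XS.
have tele := telescope_sumr (fun t => value N gam T t (X t)) sT.
rewrite value_last sub0r in tele.
rewrite -[value _ _ _ s _]opprK -tele -sumrN -big_split /=.
apply: eq_big_nat => t st; have [st1 st2] := andP st.
have tT : (1 <= t <= T)%N by rewrite (leq_trans s1 st1).
rewrite XS// dynamics_noise valueD//.
have := stage_value n_gt0 cost_pos gam_gt0 gam_pos (X t) (U t) (D t) tT.
lra.
Qed.

End Plays.

(** * Integrability from a finite expectation *)

Section Expectations.
Context {R : realType} {d : measure_display} {Omega : measurableType d}.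
Variable P : probability Omega R.

Notation L1 f := (f \in Lfun P 1).
Notation L2 f := (f \in Lfun P 2%:E).
Notation sq X := (entries_in (fun f : Omega -> R => f \in Lfun P 2%:E) X).

(** The negative part of [f] is at most [|q|], so the expectation of [f] can be
    less than [+oo] only if its positive part is integrable as well. *)
Lemma L1_of_expectation (f q : Omega -> R) :
  measurable_fun setT f -> L1 q -> (forall o, 0 <= f o + q o) ->
  ('E_P[f] < +oo)%E -> L1 f.
Proof.
move=> mf q1 fq0; rewrite unlock => Ef.
have mF : measurable_fun setT (EFin \o f) by exact/measurable_EFinP.
have iq : P.-integrable setT (EFin \o q) by exact/Lfun1_integrable.
have neg : (\int[P]_x (EFin \o f)^\- x < +oo)%E.
  have /integrableP[mq] := iq; apply: le_lt_trans.
  apply: ge0_le_integral => //.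
  - exact: measurable_funeneg.
  - exact: measurableT_comp.
  move=> x _; rewrite funenegE/= ge_max !lee_fin normr_ge0 andbT.
  by have := fq0 x; have := ler_norm (q x); lra.
have neg_fin : (\int[P]_x (EFin \o f)^\- x)%E \is a fin_num.
  by rewrite ge0_fin_numE// integral_ge0.
have pos : (\int[P]_x (EFin \o f)^\+ x < +oo)%E.
  move: Ef; rewrite integralE -(fineK neg_fin).
  by case: (\int[P]_x (EFin \o f)^\+ x)%E => [r| |]; rewrite ?ltry ?ltNyr.
apply/Lfun1_integrable/integrableP; split=> //.
under eq_integral => x _ do rewrite -/((abse \o (EFin \o f)) x) fune_abse.
rewrite ge0_integralD//; [|exact: measurable_funepos|exact: measurable_funeneg].
by rewrite lte_add_pinfty.
Qed.

Lemma L1_le (f g : Omega -> R) : measurable_fun setT f -> L1 g ->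
  (forall o, 0 <= f o <= g o) -> L1 f.
Proof.
move=> mf g1 fg; apply/Lfun1_integrable.
apply: (le_integrable measurableT) ((Lfun1_integrable _ _).1 g1).
  exact/measurable_EFinP.
move=> x _; rewrite /= lee_fin; have /andP[f0 fg'] := fg x.
by rewrite !ger0_norm// (le_trans f0).
Qed.

Lemma L2_of_sqr (f : Omega -> R) : measurable_fun setT f ->
  L1 (fun o => f o ^+ 2) -> L2 f.
Proof.
move=> mf /Lfun1_integrable f2.
apply/andP; split; rewrite inE//= /finite_norm unlock /Lnorm poweR_lty//.
rewrite (eq_integral (fun x => (f x ^+ 2)%:E)); first exact: integrable_lty.
by move=> x _; rewrite /= powR_mulrn// real_normK// num_real.
Qed.

End Expectations.

(** * Saddle points *)

Section Game.
Context {R : realType} {n lx lu : nat}.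
Context {d : measure_display} {Omega : measurableType d}.
Variables (P : probability Omega R) (N : network R lx lu) (gam : R) (T : nat).
Variables (x1 : Omega -> 'M[R]_(lx, 1 + n)).
Variables (w : nat -> Omega -> 'M[R]_(lx, 1 + n)).

Notation L1 f := (f \in Lfun P 1).
Notation L2 f := (f \in Lfun P 2%:E).
Notation sq X := (entries_in (fun f : Omega -> R => f \in Lfun P 2%:E) X).
Notation "''E' f" := (mean_value P f) (at level 10, f at level 8).

Let lin2 := L2_linear_class P.
Let lin1 := L1_linear_class P.

Hypothesis n_gt0 : (0 < n)%N.

Lemma L1_value t (X : Omega -> 'M[R]_(lx, 1 + n)) : sq X ->
  L1 (fun o => value N gam T t (X o)).
Proof.
move=> X2; apply: (classD lin1).
  apply: (classZ lin1); apply: (class_sum lin1) => i _.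
  exact: (L1_quad _ (entries_deviation lin2 i X2)).
exact: (L1_quad _ (entries_leader_mean lin2 X2)).
Qed.

Lemma L1_value_form t (X Y : Omega -> 'M[R]_(lx, 1 + n)) : sq X -> sq Y ->
  L1 (fun o => value_form N gam T t (X o) (Y o)).
Proof.
move=> X2 Y2; apply: (classD lin1).
  apply: (classZ lin1); apply: (class_sum lin1) => i _.
  apply: L1_dot; first exact: (entries_deviation lin2 i X2).
  exact: (entries_mulmx lin2 _ (entries_deviation lin2 i Y2)).
apply: L1_dot; first exact: (entries_leader_mean lin2 X2).
exact: (entries_mulmx lin2 _ (entries_leader_mean lin2 Y2)).
Qed.

Lemma L1_sqnorm l (X : Omega -> 'cV[R]_l) : sq X -> L1 (fun o => sqnorm (X o)).
Proof. by move=> X2; apply: L1_dot. Qed.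

Lemma L1_energy l (D : Omega -> 'M[R]_(l, 1 + n)) : sq D ->
  L1 (fun o => energy (D o)).
Proof.
move=> D2; apply: (classD lin1).
  apply: (classZ lin1); apply: (class_sum lin1) => i _.
  exact: (L1_sqnorm (entries_follower lin2 i D2)).
exact: (L1_sqnorm (entries_leader lin2 D2)).
Qed.

Lemma L1_surplus l m A B Q Rm t (V : Omega -> 'cV[R]_m)
    (D : Omega -> 'cV[R]_l) :
  sq V -> sq D -> L1 (fun o => surplus A B Q Rm gam T t (V o) (D o)).
Proof.
move=> V2 D2; apply: (classD lin1).
  apply: (classD lin1); first exact: L1_quad.
  have := classZ lin1 (- gam ^+ 2) (L1_sqnorm D2).
  by congr (L1 _); apply/funext => o; rewrite mulNr.
apply: L1_quad; apply: (entriesD lin2) => //; exact: (entries_mulmx lin2).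
Qed.

Lemma L1_game_surplus t (U : Omega -> 'M[R]_(lu, 1 + n))
    (D : Omega -> 'M[R]_(lx, 1 + n)) : sq U -> sq D ->
  L1 (fun o => game_surplus N gam T t (U o) (D o)).
Proof.
move=> U2 D2; apply: (classD lin1).
  apply: (classZ lin1); apply: (class_sum lin1) => i _.
  exact: L1_surplus (entries_deviation lin2 i U2) (entries_deviation lin2 i D2).
exact: L1_surplus (entries_leader_mean lin2 U2) (entries_leader_mean lin2 D2).
Qed.

Lemma L2_orthogonal_value_form t (X Y : Omega -> 'M[R]_(lx, 1 + n)) :
  sq X -> sq Y ->
  (forall i j k l, L2_orthogonal P (fun o => X o i j) (fun o => Y o k l)) ->
  'E (fun o => value_form N gam T t (X o) (Y o)) = 0.
Proof.
move=> X2 Y2 XY.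
have dev i M :
    'E (fun o => dot (deviation i (X o)) (M *m deviation i (Y o))) = 0.
  apply: L2_orthogonal_dot => k l.
  exact: (L2_orthogonal_linear (deviation i) (mulmx M \o deviation i)).
have lead M :
    'E (fun o => dot (leader_mean (X o)) (M *m leader_mean (Y o))) = 0.
  apply: L2_orthogonal_dot => k l.
  exact: (L2_orthogonal_linear leader_mean (mulmx M \o leader_mean)).
have dev1 i M : L1 (fun o => dot (deviation i (X o)) (M *m deviation i (Y o))).
  apply: L1_dot; first exact: (entries_deviation lin2 i X2).
  exact: (entries_mulmx lin2 _ (entries_deviation lin2 i Y2)).
have sum1 := mean_value_sum (P := P) (fun i _ _ => dev1 i (breveM N gam T t)).
have [sum0 sumL] := sum1 (index_enum _) xpredT.
rewrite mean_valueD ?mean_valueZ//.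
- by rewrite sum0 lead addr0 big1 ?mulr0.
- exact: (classZ lin1).
- apply: L1_dot; first exact: (entries_leader_mean lin2 X2).
  exact: (entries_mulmx lin2 _ (entries_leader_mean lin2 Y2)).
Qed.

Hypothesis indep : mutually_independent P (primitive T w x1).
Hypothesis x1_L2 : square_integrable P x1.
Hypothesis w_L2 : forall t, (1 <= t <= T)%N -> square_integrable P (w t).
Hypothesis w_mean : forall t, (1 <= t <= T)%N -> centred P (w t).

Notation prim := (primitive T w x1).

(** What is known when the decisions at time [t] are made: the initial states,
    which have the time index 0, and the noises strictly before [t]. *)
Definition past t : {set 'I_T.+1 * 'I_(1 + n)} :=
  [set p : 'I_T.+1 * 'I_(1 + n) | (p.1 < t)%N]%SET.

Definition adapted t (f : Omega -> R) : Prop :=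
  measurable_fun [set: g_sigma_algebraType (events prim (past t))]
    (f : g_sigma_algebraType (events prim (past t)) -> R).

Lemma adapted_linear_class t : linear_class (adapted t).
Proof. exact: measurable_linear_class. Qed.

Lemma primitive_sq p : sq (prim p).
Proof.
move=> i j; case: p => -[[|t] tT] k; rewrite /primitive /=.
  by have := x1_L2 i k; congr (L2 _); apply/funext => o; rewrite mxE.
have := w_L2 (t := t.+1) tT i k.
by congr (L2 _); apply/funext => o; rewrite mxE.
Qed.

Lemma primitive_measurable p : measurable_entries (prim p).
Proof. by move=> i j; apply: L2_measurable; exact: primitive_sq. Qed.

Lemma noise_coord t (tT : (t < T.+1)%N) o i k :
  (if t is t'.+1 then w t'.+1 o else x1 o) i k
  = prim (Ordinal tT, k) o i ord0.
Proof. by rewrite /primitive /= mxE. Qed.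

Lemma adapted_x1 t : (1 <= t)%N -> entries_in (adapted t) x1.
Proof.
move=> t1 i k; have := @events_coord _ _ _ _ _ _ prim (past t)
  (Ordinal (ltn0Sn T), k) i ord0.
rewrite inE => /(_ t1); congr measurable_fun; apply/funext => o.
by rewrite -(noise_coord (t := 0)).
Qed.

Lemma adapted_w t u : (1 <= u <= T)%N -> (u < t)%N ->
  entries_in (adapted t) (w u).
Proof.
move=> /andP[u1 uT] ut i k; have := @events_coord _ _ _ _ _ _ prim (past t)
  (Ordinal (uT : (u < T.+1)%N), k) i ord0.
rewrite inE => /(_ ut); congr measurable_fun; apply/funext => o.
by rewrite -noise_coord; case: u u1 {uT ut}.
Qed.

Lemma noise_zero_mean t : (1 <= t <= T)%N -> entries_in (zero_mean P) (w t).
Proof. by move=> tT i j; split; [exact: w_L2|exact: w_mean]. Qed.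

(** The noise at time [t] is centred, and independent of the primitive variables
    that determine [X]. *)
Lemma adapted_L2_orthogonal t m k (X : Omega -> 'M[R]_(m, k)) :
  (1 <= t <= T)%N -> entries_in (adapted t) X -> sq X ->
  forall i j i' j', L2_orthogonal P (fun o => X o i j) (fun o => w t o i' j').
Proof.
move=> tT aX X2 i j i' j'; have [w2 w0] := noise_zero_mean tT i' j'.
have [t1 tleT] := andP tT.
split; first exact: X2; split=> //.
have wE : (fun o => w t o i' j')
    = (fun o => prim (Ordinal (tleT : (t < T.+1)%N), j') o i' ord0).
  by apply/funext => o; rewrite -noise_coord; case: t t1 {tT aX w2 w0 tleT}.
have := @expectation_events _ _ _ P _ _ _ prim primitive_measurable indep
  (past t) (Ordinal (tleT : (t < T.+1)%N), j') i' ord0 (fun o => X o i j).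
rewrite inE /= ltnn -wE => /(_ erefl (aX i j) (X2 i j) w2 w0) E0.
rewrite /mean_value (_ : 'E_P[_] = 0)%E// -[RHS]E0.
congr expectation; apply/funext => o.
by have := congr1 (fun f => f o) wE => /= ->.
Qed.

Hypothesis cost_pos : forall t, (1 <= t <= T)%N ->
  [/\ possemidef (mQ N t), possemidef (barQ N t),
      posdef (mR N t) & posdef (barR N t)].
Hypothesis gam_gt0 : 0 < gam.
Hypothesis gam_pos : forall t, (1 <= t <= T - 1)%N ->
  posdef ((gam ^+ 2)%:M - breveM N gam T t.+1) /\
  posdef ((gam ^+ 2)%:M - barM N gam T t.+1).

Definition nonanticipative s (xi : Omega -> 'M[R]_(lx, 1 + n)) :=
  square_integrable P xi /\ forall t, (s <= t)%N -> entries_in (adapted t) xi.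

Lemma nonanticipative_x1 : nonanticipative 1 x1.
Proof. by split=> // t; exact: adapted_x1. Qed.

Lemma nonanticipative_cst s X : nonanticipative s (cst X).
Proof.
split=> [i j|t _ i j]; first exact: L2_cst.
exact: measurable_cst.
Qed.

Definition saddle_value s (xi : Omega -> 'M[R]_(lx, 1 + n)) : R :=
  'E (fun o => value N gam T s (xi o))
  + \sum_(s <= t < T.+1) 'E (fun o => value N gam T t.+1 (w t o)).

Section Play.
Variables (s : nat) (xi : Omega -> 'M[R]_(lx, 1 + n)).
Variables (g : strategy R n lx lu) (dl : disturbance R n lx).
Hypothesis sT : (1 <= s <= T.+1)%N.
Hypothesis xi_start : nonanticipative s xi.
Hypothesis mg : measurable_strategy g.
Hypothesis mdl : forall t, mx_measurable (dl t).

Notation X t := (state N w s xi g dl t).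
Notation U t := (fun o => actions g t (X t o)).
Notation D t := (fun o => dl t (X t o)).

Let s_ge1 t : (s <= t)%N -> (1 <= t)%N.
Proof. by apply: leq_trans; case/andP: sT. Qed.

Lemma adapted_state t : (s <= t <= T.+1)%N -> entries_in (adapted t) (X t).
Proof.
move=> /andP[st tT].
have := @measurable_state _ _ _ _ N _
  (g_sigma_algebraType (events prim (past t))) w s xi g dl t mg mdl
  (xi_start.2 t st) _ t.
rewrite st leqnn => /(_ _ isT); apply => u /andP[su ut].
by apply: adapted_w => //; rewrite s_ge1// -ltnS (leq_trans ut).
Qed.

Lemma measurable_play t : (s <= t <= T.+1)%N -> measurable_entries (X t).
Proof.
apply: measurable_state => // [i j|u /andP[su uT] i j].
  exact/L2_measurable/xi_start.1.
by apply/L2_measurable/w_L2; rewrite s_ge1.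
Qed.

Lemma sq_state m : (m <= T.+1)%N ->
  (forall t, (s <= t < m)%N -> sq (X t) -> sq (U t) /\ sq (D t)) ->
  forall t, (s <= t <= m)%N -> sq (X t).
Proof.
move=> mT sqUD; apply: state_ind => [|t stm X2].
  by move=> i j; under eq_fun do rewrite stateE; exact: xi_start.1.
have [st tm] := andP stm; have [U2 D2] := sqUD t stm X2.
have w2 : sq (w t) by apply: w_L2; rewrite s_ge1// -ltnS (leq_trans tm).
have := entries_dynamics lin2 N t X2 U2 D2 w2.
by move=> S2 i j; under eq_fun do rewrite stateS//; exact: S2.
Qed.

Lemma sq_dynamics t : sq (X t) -> sq (U t) -> sq (D t) ->
  sq (fun o => dynamics N t (X t o) (U t o) (D t o) 0).
Proof.
by move=> X2 U2 D2; apply: (entries_dynamics lin2) => //; exact: entries0.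
Qed.

Lemma adapted_dynamics t : (s <= t <= T.+1)%N ->
  entries_in (adapted t) (fun o => dynamics N t (X t o) (U t o) (D t o) 0).
Proof.
move=> stT; have aX := adapted_state stT.
apply: (entries_dynamics (adapted_linear_class t)) => //.
- exact: measurable_actions mg aX.
- exact: measurable_entries_comp (mdl t) aX.
- exact: (entries0 (adapted_linear_class t)).
Qed.

(** The bilinear terms of [play_cost] have zero mean: the next state without
    noise is determined by the past, to which the noise is orthogonal. *)
Lemma cost_square_integrable :
  (forall t, (s <= t <= T)%N -> sq (X t) -> sq (U t) /\ sq (D t)) ->
  cost P N gam T w s xi g dl
  = (saddle_value s xi + \sum_(s <= t < T.+1)
       'E (fun o => game_surplus N gam T t
                      (U t o - saddle_action N gam T t (X t o))
                      (D t o - saddle_disturbance N gam T t (X t o))))%:E.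
Proof.
move=> sqUD; have X2 := sq_state (leqnn _) sqUD.
have X2' t : (s <= t <= T)%N -> sq (X t).
  by move=> /andP[st tT]; apply: X2; rewrite st ltnW.
pose V t o := value N gam T t.+1 (w t o).
pose B t o := value_form N gam T t.+1
  (dynamics N t (X t o) (U t o) (D t o) 0) (w t o).
pose G t o := game_surplus N gam T t (U t o - saddle_action N gam T t (X t o))
  (D t o - saddle_disturbance N gam T t (X t o)).
have w2 t : (s <= t <= T)%N -> sq (w t).
  by move=> /andP[st tT]; apply: w_L2; rewrite s_ge1.
have V1 t : (s <= t <= T)%N -> L1 (V t) by move=> /w2; exact: L1_value.
have B1 t : (s <= t <= T)%N -> L1 (B t).
  move=> stT; have [U2 D2] := sqUD t stT (X2' t stT).
  by apply: L1_value_form; [apply: sq_dynamics => //; exact: X2'|exact: w2].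
have G1 t : (s <= t <= T)%N -> L1 (G t).
  move=> stT; have [U2 D2] := sqUD t stT (X2' t stT).
  apply: L1_game_surplus; apply: (entriesB lin2) => //.
    exact: (entries_saddle_action lin2 _ _ _ _ (X2' t stT)).
  exact: (entries_saddle_disturbance lin2 _ _ _ _ (X2' t stT)).
have EB t : (s <= t <= T)%N -> 'E (B t) = 0.
  move=> stT; have [U2 D2] := sqUD t stT (X2' t stT).
  have stT' : (s <= t <= T.+1)%N by case/andP: stT => -> /= /leqW.
  have hat2 := sq_dynamics (X2' t stT) U2 D2.
  apply: L2_orthogonal_value_form; [exact: hat2|exact: w2|].
  apply: adapted_L2_orthogonal => //; last exact: adapted_dynamics.
  by case/andP: stT => /s_ge1-> ->.
pose H t o := V t o + 2 * B t o + G t o.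
have H1 t : (s <= t <= T)%N -> L1 (H t) /\ 'E (H t) = 'E (V t) + 'E (G t).
  move=> stT; have v1 := V1 t stT; have b1 := B1 t stT; have g1 := G1 t stT.
  have bb1 : L1 (fun o => 2 * B t o) by exact: (classZ lin1).
  have vb1 : L1 (fun o => V t o + 2 * B t o) by exact: (classD lin1).
  split; first exact: (classD lin1).
  by rewrite mean_valueD// mean_valueD// mean_valueZ// EB// mulr0 addr0.
have costE o : \sum_(s <= t < T.+1) stage_cost N gam t (X t o) (U t o) (D t o)
    = value N gam T s (xi o) + \sum_(s <= t < T.+1) H t o.
  rewrite (@play_cost _ _ _ _ N gam T n_gt0 cost_pos gam_gt0 gam_pos s
    (fun t => X t o) (fun t => U t o) (fun t => D t o) (fun t => w t o) sT).
    by rewrite stateE.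
  by move=> t /andP[st _]; rewrite stateS.
have [|EH SH] := @mean_value_sum _ _ _ P nat (index_iota s T.+1) xpredT H.
  by move=> t; rewrite mem_index_iota ltnS => /H1[].
have xi1 : L1 (fun o => value N gam T s (xi o)).
  by apply: L1_value; exact: xi_start.1.
rewrite /cost; under eq_fun do rewrite costE.
rewrite mean_valueK; last exact: (classD lin1).
rewrite mean_valueD// EH /saddle_value -addrA -big_split /=.
congr (_ + _)%:E; apply: eq_big_nat => t; rewrite ltnS => /H1[_ ->].
by [].
Qed.

(** The control weights are positive definite, so a finite cost forces the
    actions to have finite second moments. *)
Lemma finite_cost_actions :
  (forall t, (s <= t <= T)%N -> sq (D t)) ->
  (cost P N gam T w s xi g dl < +oo)%E ->
  forall t, (s <= t <= T)%N -> sq (U t).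
Proof.
move=> D2 fin.
have stT' t : (s <= t <= T)%N -> (s <= t <= T.+1)%N.
  by move=> /andP[-> /leqW].
have tT t : (s <= t <= T)%N -> (1 <= t <= T)%N.
  by move=> /andP[/s_ge1-> ->].
have mX t (stT : (s <= t <= T)%N) := measurable_play (stT' t stT).
have mU t (stT : (s <= t <= T)%N) := measurable_actions t mg (mX t stT).
have mD t (stT : (s <= t <= T)%N) := measurable_entries_comp (mdl t) (mX t stT).
pose c t o := stage_cost N gam t (X t o) (U t o) (D t o).
pose q t o := gam ^+ 2 * energy (D t o).
have mc t : (s <= t <= T)%N -> measurable_fun setT (c t).
  move=> stT; exact: measurable_stage_cost (mX t stT) (mU t stT) (mD t stT).
have q1 t : (s <= t <= T)%N -> L1 (q t).
  by move=> stT; apply: (classZ lin1); apply: L1_energy; exact: D2.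
have cq_ge0 t o : (s <= t <= T)%N -> 0 <= c t o + q t o.
  by move=> /tT; exact: stage_cost_ge0.
have [|_ SQ] := @mean_value_sum _ _ _ P nat (index_iota s T.+1) xpredT q.
  by move=> t; rewrite mem_index_iota ltnS => /q1.
have mC : measurable_fun setT (fun o => \sum_(s <= t < T.+1) c t o).
  under eq_fun do rewrite big_nat.
  apply: (class_sum (measurable_linear_class (R := R) Omega)) => t.
  by rewrite ltnS; exact: mc.
have sum_ge0 o : 0 <= \sum_(s <= t < T.+1) c t o + \sum_(s <= t < T.+1) q t o.
  rewrite -big_split /= big_nat sumr_ge0// => t; rewrite ltnS => stT.
  exact: cq_ge0.
have SC := L1_of_expectation mC SQ sum_ge0 fin.
have SCQ := classD lin1 SC SQ.
move=> t stT i j.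
have [C C0 coercive] := stage_cost_coercive gam n_gt0 cost_pos (tT t stT).
apply: L2_of_sqr; first exact: mU.
apply: L1_le (classZ lin1 C SCQ) _.
  by apply: measurable_funX; exact: mU.
move=> o; rewrite sqr_ge0/=; apply: le_trans (coercive (X t o) _ (D t o) i j) _.
rewrite ler_pM2l// -big_split /=.
rewrite (bigD1_seq t) ?mem_index_iota ?iota_uniq//= lerDl big_seq_cond.
rewrite sumr_ge0// => u; rewrite mem_index_iota ltnS => /andP[/cq_ge0-> //].
Qed.

End Play.

Notation gS := (saddle_strategy (n := n) N gam T).
Notation dS := (saddle_disturbance (n := n) N gam T).

Let mgS : measurable_strategy gS := measurable_saddle_strategy N gam T.
Let mdS t : mx_measurable (dS t) := measurable_saddle_disturbance N gam T t.

Lemma saddle_action_sq t (X : Omega -> 'M[R]_(lx, 1 + n)) :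
  sq X -> sq (fun o => actions gS t (X o)).
Proof.
move=> X2; rewrite (funext (fun o => saddle_strategy_actions N gam T t (X o))).
exact: (entries_saddle_action lin2 _ _ _ _ X2).
Qed.

Lemma saddle_disturbance_sq t (X : Omega -> 'M[R]_(lx, 1 + n)) :
  sq X -> sq (fun o => dS t (X o)).
Proof. exact: (entries_saddle_disturbance lin2). Qed.

Section Start.
Variables (s : nat) (xi : Omega -> 'M[R]_(lx, 1 + n)).
Hypothesis sT : (1 <= s <= T.+1)%N.
Hypothesis xi_start : nonanticipative s xi.

Lemma admissible_saddle : admissible P N T w s xi gS dS.
Proof.
split=> // t /andP[st tT]; apply: saddle_disturbance_sq.
apply: (sq_state sT xi_start (leqnn _)); last by rewrite st ltnW.
by move=> u _ X2; split; [exact: saddle_action_sq|exact: saddle_disturbance_sq].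
Qed.

Lemma cost_saddle :
  cost P N gam T w s xi gS dS = (saddle_value s xi)%:E.
Proof.
rewrite (cost_square_integrable sT xi_start mgS mdS); last first.
  move=> u _ X2; split; first exact: saddle_action_sq.
  exact: saddle_disturbance_sq.
rewrite big_nat big1 ?addr0// => t /andP[st]; rewrite ltnS => tT.
under eq_fun do rewrite saddle_strategy_actions !subrr.
rewrite game_surplus0.
exact: mean_value0.
Qed.

Lemma cost_saddle_strategy dl : admissible P N T w s xi gS dl ->
  (cost P N gam T w s xi gS dl <= (saddle_value s xi)%:E)%E.
Proof.
move=> [_ mdl D2].
rewrite (cost_square_integrable sT xi_start mgS mdl); last first.
  by move=> u su X2; split; [exact: saddle_action_sq|exact: D2].
rewrite lee_fin gerDl big_nat sumr_le0// => t /andP[st]; rewrite ltnS => tT.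
have tT' : (1 <= t <= T)%N by rewrite tT andbT; case/andP: sT => /leq_trans ->.
apply: mean_value_le0 => o; rewrite saddle_strategy_actions subrr.
exact: (game_surplus_disturbance n_gt0 gam_gt0 gam_pos _ tT').1.
Qed.

(** An infinite cost is no better for the controller; a finite one makes all the
    second moments finite, so that the decomposition of the cost applies. *)
Lemma cost_saddle_disturbance g : measurable_strategy g ->
  (forall t, (s <= t <= T)%N -> sq (fun o => dS t (state N w s xi g dS t o))) ->
  ((saddle_value s xi)%:E <= cost P N gam T w s xi g dS)%E.
Proof.
move=> mg D2.
have [fin|inf] := boolP (cost P N gam T w s xi g dS < +oo)%E; last first.
  by move: inf; rewrite -leNgt leye_eq => /eqP->; rewrite leey.
have U2 := finite_cost_actions sT xi_start mg mdS D2 fin.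
rewrite (cost_square_integrable sT xi_start mg mdS); last first.
  by move=> t st _; split; [exact: U2|exact: D2].
rewrite lee_fin lerDl big_nat sumr_ge0// => t /andP[st]; rewrite ltnS => tT.
have tT' : (1 <= t <= T)%N by rewrite tT andbT; case/andP: sT => /leq_trans ->.
apply: mean_value_ge0 => o; rewrite subrr.
exact: (game_surplus_action n_gt0 cost_pos gam_gt0 gam_pos _ tT').1.
Qed.

Lemma saddle_point_saddle : saddle_point P N gam T w s xi gS dS.
Proof.
split; first exact: admissible_saddle.
  by move=> dl; rewrite cost_saddle; exact: cost_saddle_strategy.
by move=> g [mg _ D2]; rewrite cost_saddle; exact: cost_saddle_disturbance.
Qed.

(** Against an arbitrary strategy the saddle-point disturbance may have infinite
    energy. It is then switched off after the first time at which the actions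
    have infinite energy, which keeps it admissible and the cost infinite. *)
Lemma upper_cost_ge g : measurable_strategy g ->
  ((saddle_value s xi)%:E <= upper_cost P N gam T w s xi g)%E.
Proof.
move=> mg.
have [U2|nU2] := pselect (forall t, (s <= t <= T)%N ->
    sq (fun o => actions g t (state N w s xi g dS t o))).
  have D2 t : (s <= t <= T)%N -> sq (fun o => dS t (state N w s xi g dS t o)).
    move=> /andP[st tT]; apply: saddle_disturbance_sq.
    apply: (sq_state sT xi_start (leqnn _)); last by rewrite st ltnW.
    by move=> u su X2; split; [exact: U2|exact: saddle_disturbance_sq].
  apply: le_trans (cost_saddle_disturbance mg D2) _.
  by apply: ereal_sup_ubound; exists dS.
pose bad t := (s <= t <= T)%N &&
  ~~ `[< sq (fun o => actions g t (state N w s xi g dS t o)) >].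
have exbad : exists t, bad t.
  apply: contrapT => nbad; apply: nU2 => t st; apply: contrapT => nsq.
  by apply: nbad; exists t; rewrite /bad st/=; apply/asboolPn.
case: (ex_minnP exbad) => m /andP[sm /asboolPn nsq] m_min.
have [smS mT] := andP sm.
pose dl t X := if (t < m.+1)%N then dS t X else 0.
have mdl t : mx_measurable (dl t).
  rewrite /dl; case: (t < m.+1)%N; first exact: mdS.
  apply: mx_measurableP => d' S f _; exact: measurable_entries_cst.
have same t : (s <= t <= m.+1)%N ->
    state N w s xi g dl t = state N w s xi g dS t.
  by apply: eq_state => u X /andP[_ um]; rewrite /dl um.
have X2 t : (s <= t <= m)%N -> sq (state N w s xi g dl t).
  apply: (sq_state sT xi_start (leqW mT)) => u /andP[su um] Xu2.
  split; last by rewrite /dl ltnS ltnW//; exact: saddle_disturbance_sq.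
  have -> : state N w s xi g dl u = state N w s xi g dS u.
    by apply: same; rewrite su/= ltnW// ltnW.
  apply: contrapT => /asboolPn nsqu; have := m_min u.
  by rewrite /bad su (leq_trans (ltnW um) mT) nsqu leqNgt um => /(_ isT).
have D2 t : (s <= t <= T)%N -> sq (fun o => dl t (state N w s xi g dl t o)).
  move=> /andP[st tT]; rewrite /dl ltnS; case: (leqP t m) => tm.
    by apply: saddle_disturbance_sq; apply: X2; rewrite st.
  exact: (entries0 lin2).
have -> : upper_cost P N gam T w s xi g = +oo%E; last exact: leey.
apply/eqP; rewrite -leye_eq.
apply: le_trans (_ : cost P N gam T w s xi g dl <= _)%E.
  rewrite leNgt; apply/negP => fin; apply: nsq.
  have <- : state N w s xi g dl m = state N w s xi g dS m.
    by apply: same; rewrite smS/=.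
  exact: finite_cost_actions sT xi_start mg mdl D2 fin m sm.
by apply: ereal_sup_ubound; exists dl.
Qed.

Lemma upper_cost_saddle :
  upper_cost P N gam T w s xi gS = (saddle_value s xi)%:E.
Proof.
apply/eqP; rewrite eq_le upper_cost_ge// andbT; apply: ge_ereal_sup.
by move=> _ [dl adm <-]; exact: cost_saddle_strategy.
Qed.

Lemma minimax_saddle : minimax_value P N gam T w s xi = (saddle_value s xi)%:E.
Proof.
apply/eqP; rewrite eq_le; apply/andP; split.
  by rewrite -upper_cost_saddle; apply: ereal_inf_lbound; exists gS.
by apply: le_ereal_inf_tmp => _ [g mg <-]; exact: upper_cost_ge.
Qed.

End Start.

(** The surplus vanishes wherever the saddle-point laws are followed, so only
    the decisions at time [t] matter: the subgame is a one-stage game. *)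
Lemma one_shot_deviation t X g dl : (1 <= t <= T)%N ->
  measurable_strategy g -> (forall u, mx_measurable (dl u)) ->
  (forall u Y, (t < u <= T)%N ->
     actions g u Y = saddle_action N gam T u Y /\ dl u Y = dS u Y) ->
  admissible P N T w t (cst X) g dl /\
  cost P N gam T w t (cst X) g dl
  = (saddle_value t (cst X)
     + game_surplus N gam T t (actions g t X - saddle_action N gam T t X)
                              (dl t X - dS t X))%:E.
Proof.
move=> tT mg mdl follows; have [t1 tleT] := andP tT.
have tT' : (1 <= t <= T.+1)%N by rewrite t1 leqW.
have start := nonanticipative_cst t X.
have st o : state N w t (cst X) g dl t o = X by rewrite stateE.
have sqUD u : (t <= u <= T)%N -> sq (state N w t (cst X) g dl u) ->
    sq (fun o => actions g u (state N w t (cst X) g dl u o)) /\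
    sq (fun o => dl u (state N w t (cst X) g dl u o)).
  move=> /andP[]; rewrite leq_eqVlt => /orP[/eqP<- _ _|tu uT X2].
    by split=> i j; under eq_fun do rewrite st; exact: L2_cst.
  have tuT : (t < u <= T)%N by rewrite tu.
  split.
    rewrite (funext
      (fun o => (follows u (state N w t (cst X) g dl u o) tuT).1)).
    exact: (entries_saddle_action lin2 _ _ _ _ X2).
  rewrite (funext (fun o => (follows u (state N w t (cst X) g dl u o) tuT).2)).
  exact: saddle_disturbance_sq.
have X2 := sq_state tT' start (leqnn _) sqUD.
split.
  split=> // u tu; apply: (sqUD u tu _).2; apply: X2.
  by case/andP: tu => -> /= /leqW.
rewrite (cost_square_integrable tT' start mg mdl sqUD); congr (_ + _)%:E.
rewrite big_ltn ?ltnS// big_nat big1 ?addr0.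
  by under eq_fun do rewrite st; rewrite /mean_value expectation_cst.
move=> u tu; rewrite ltnS in tu.
under eq_fun do rewrite (follows u _ tu).1 (follows u _ tu).2 !subrr.
rewrite game_surplus0.
exact: mean_value0.
Qed.

(** Backward induction: once the laws after time [t] are known, the subgames
    starting at time [t] are one-stage games with a strict saddle point. The
    deviations [g'] and [dl'] play the saddle-point laws at time [t]. *)
Lemma feedback_saddle_unique g dl :
  feedback_saddle_point P N gam T w x1 g dl ->
  forall t X, (1 <= t <= T)%N ->
  actions g t X = saddle_action N gam T t X /\ dl t X = dS t X.
Proof.
move=> [[[mg mdl _] _ _] sub] t.
have [k] := ubnP (T - t); elim: k t => // k IHk t Tt X tT.
have follows u Y : (t < u <= T)%N ->
    actions g u Y = saddle_action N gam T u Y /\ dl u Y = dS u Y.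
  move=> /andP[tu uT]; apply: IHk; last by rewrite uT (leq_trans _ tu).
  rewrite -ltnS; apply: leq_ltn_trans Tt; rewrite ltn_sub2l//.
  exact: leq_trans tu uT.
have [_ costgd] := one_shot_deviation X tT mg mdl follows.
pose g' : strategy R n lx lu := Strategy
  (fun u => if u == t then leader_law gS u else leader_law g u)
  (fun u i => if u == t then follower_law gS u i else follower_law g u i).
pose dl' : disturbance R n lx := fun u => if u == t then dS u else dl u.
have g'E u Y :
    actions g' u Y = if u == t then actions gS u Y else actions g u Y.
  by rewrite /actions /leader_action /follower_action /=; case: eqP.
have mg' : measurable_strategy g'.
  split=> [u|u i] /=; case: ifP => _;
    by [exact: mgS.1|exact: mg.1|exact: mgS.2|exact: mg.2].
have mdl' u : mx_measurable (dl' u) by rewrite /dl'; case: ifP.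
have follows1 u Y : (t < u <= T)%N ->
    actions g' u Y = saddle_action N gam T u Y /\ dl u Y = dS u Y.
  by move=> tu; rewrite g'E gtn_eqF; [exact: follows|case/andP: tu].
have follows2 u Y : (t < u <= T)%N ->
    actions g u Y = saddle_action N gam T u Y /\ dl' u Y = dS u Y.
  by move=> tu; rewrite /dl' gtn_eqF; [exact: follows|case/andP: tu].
have [adm1 cost1] := one_shot_deviation X tT mg' mdl follows1.
have [adm2 cost2] := one_shot_deviation X tT mg mdl' follows2.
have [_ /(_ _ adm2) le2 /(_ _ adm1) le1] := sub t X tT.
move: le1 le2; rewrite costgd cost1 cost2 g'E /dl' !eqxx.
rewrite saddle_strategy_actions !subrr !lee_fin !lerD2l => le1 le2.
set u := actions g t X - _ in le1 le2; set e := dl t X - _ in le1 le2.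
have [ge0 u0] := game_surplus_action n_gt0 cost_pos gam_gt0 gam_pos u tT.
have [le0 e0] := game_surplus_disturbance n_gt0 gam_gt0 gam_pos e tT.
split; apply/subr0_eq; [apply: u0|apply: e0].
  exact: le_trans (le_trans le2 le1) le0.
exact: le_trans ge0 (le_trans le2 le1).
Qed.

Lemma feedback_saddle_cost g dl :
  feedback_saddle_point P N gam T w x1 g dl ->
  cost P N gam T w 1 x1 g dl = cost P N gam T w 1 x1 gS dS.
Proof.
move=> fsp; have uniq := feedback_saddle_unique fsp.
have laws t X : (1 <= t < T.+1)%N ->
    actions g t X = actions gS t X /\ dl t X = dS t X.
  by move=> tT; rewrite saddle_strategy_actions; exact: uniq.
have st := eq_state N w x1 laws.
rewrite /cost; congr expectation; apply/funext => o.
apply: eq_big_nat => t tT; have [-> ->] := laws t (state N w 1 x1 g dl t o) tT.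
by rewrite st//; case/andP: tT => -> /ltnW.
Qed.

Lemma feedback_saddle : feedback_saddle_point P N gam T w x1 gS dS.
Proof.
split; first exact: (saddle_point_saddle _ nonanticipative_x1).
move=> s X /andP[s1 sT]; apply: saddle_point_saddle; first by rewrite s1 leqW.
exact: nonanticipative_cst.
Qed.

Lemma mean_value_value t (X : Omega -> 'M[R]_(lx, 1 + n)) :
  entries_in (zero_mean P) X ->
  'E (fun o => value N gam T t (X o))
  = n%:R^-1
      * (\sum_i \tr (breveM N gam T t *m Cov P (fun o => deviation i (X o))))
    + \tr (barM N gam T t *m Cov P (fun o => leader_mean (X o))).
Proof.
move=> X0; have lin0 := zero_mean_class P.
have X2 : sq X by move=> i j; case: (X0 i j).
have dev1 i : L1 (fun o => quad (breveM N gam T t) (deviation i (X o))).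
  exact: (L1_quad _ (entries_deviation lin2 i X2)).
have [|ES S1] := @mean_value_sum _ _ _ P _ (index_enum 'I_n) xpredT
  (fun i o => quad (breveM N gam T t) (deviation i (X o))); first by [].
rewrite /value mean_valueD; last 2 first.
- exact: (classZ lin1).
- exact: (L1_quad _ (entries_leader_mean lin2 X2)).
rewrite mean_valueZ// ES mean_value_quad; last first.
  exact: (entries_leader_mean lin0).
congr (_ * _ + _); apply: eq_bigr => i _; rewrite mean_value_quad//.
exact: (entries_deviation lin0).
Qed.

Lemma breve_cE i k : (k <= T)%N ->
  breve_c_rev P N gam T w i k = \sum_(T.+1 - k <= t < T.+1)
    \tr (breveM N gam T t.+1 *m Cov P (fun o => deviation i (w t o))).
Proof.
elim: k => [|k IHk] kT /=; first by rewrite subn0 big_geq.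
rewrite IHk ?(ltnW kT)// subSS subSn ?(ltnW kT)//.
by rewrite [RHS]big_ltn ?ltnS ?leq_subr// addrC.
Qed.

Lemma bar_cE k : (k <= T)%N ->
  bar_c_rev P N gam T w k = \sum_(T.+1 - k <= t < T.+1)
    \tr (barM N gam T t.+1 *m Cov P (fun o => leader_mean (w t o))).
Proof.
elim: k => [|k IHk] kT /=; first by rewrite subn0 big_geq.
rewrite IHk ?(ltnW kT)// subSS subSn ?(ltnW kT)//.
by rewrite [RHS]big_ltn ?ltnS ?leq_subr// addrC.
Qed.

Lemma saddle_valueE : centred P x1 ->
  saddle_value 1 x1 = saddle_performance P N gam T w x1.
Proof.
move=> x1_mean; rewrite /saddle_value mean_value_value; last first.
  by move=> i j; split; [exact: x1_L2|exact: x1_mean].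
have -> : \sum_(1 <= t < T.+1) 'E (fun o => value N gam T t.+1 (w t o))
    = n%:R^-1 * \sum_i breve_c P N gam T w i 1 + bar_c P N gam T w 1.
  rewrite /breve_c /bar_c subSS subn0 bar_cE// subSnn.
  under [in RHS]eq_bigr do rewrite breve_cE// subSnn.
  rewrite exchange_big /= mulr_sumr -big_split /=; apply: eq_big_nat => t tT.
  exact/mean_value_value/noise_zero_mean.
rewrite /saddle_performance big_split /=; ring.
Qed.

End Game.

(** * The saddle-point laws in block form *)

Lemma saddle_action_leader (R : realType) n lx lu (N : network R lx lu)
    gam T t (X : 'M[R]_(lx, 1 + n)) :
  leader (saddle_action N gam T t X)
  = ulsubmx (barL N gam T t) *m leader X + ursubmx (barL N gam T t) *m mean X.
Proof.
rewrite leader_joint -[in LHS](submxK (barL N gam T t)) mul_block_col.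
by rewrite col_mxKu.
Qed.

Lemma saddle_action_follower (R : realType) n lx lu (N : network R lx lu)
    gam T t (X : 'M[R]_(lx, 1 + n)) i :
  follower i (saddle_action N gam T t X)
  = breveL N gam T t *m follower i X + dlsubmx (barL N gam T t) *m leader X
    + (drsubmx (barL N gam T t) - breveL N gam T t) *m mean X.
Proof.
rewrite follower_joint -[in LHS](submxK (barL N gam T t)) mul_block_col.
rewrite col_mxKd /deviation mulmxBr mulmxBl -!addrA; congr (_ + _).
by rewrite addrCA; congr (_ + _); rewrite addrC.
Qed.

Theorem theorem1 (R : realType) (n T lx lu : nat)
  (d : measure_display) (Omega : measurableType d) (P : probability Omega R)
  (N : network R lx lu)
  (x1 : Omega -> 'M[R]_(lx, 1 + n)) (w : nat -> Omega -> 'M[R]_(lx, 1 + n))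
  (gam : R)
  (n_gt0 : (0 < n)%N) (T_gt0 : (0 < T)%N)
  (indep : mutually_independent P (primitive T w x1))
  (x1_L2 : square_integrable P x1)
  (w_L2 : forall t, (1 <= t <= T)%N -> square_integrable P (w t))
  (w_mean : forall t, (1 <= t <= T)%N -> centred P (w t))
  (cost_sym : forall t, (1 <= t <= T)%N ->
     [/\ symmetric_mx (mQ N t), symmetric_mx (mQ0 N t), symmetric_mx (mR N t)
       & symmetric_mx (mR0 N t)] /\
     [/\ symmetric_mx (mF N t), symmetric_mx (mP N t) & symmetric_mx (mH N t)])
  (cost_pos : forall t, (1 <= t <= T)%N ->
     [/\ possemidef (mQ N t), possemidef (barQ N t),
         posdef (mR N t) & posdef (barR N t)])
  (gam_gt0 : 0 < gam)
  (gam_pos : forall t, (1 <= t <= T - 1)%N ->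
     posdef ((gam ^+ 2)%:M - breveM N gam T t.+1) /\
     posdef ((gam ^+ 2)%:M - barM N gam T t.+1)) :
  [/\ exists g : strategy R n lx lu,
        [/\ feedback_saddle_strategy P N gam T w x1 g,
            upper_cost P N gam T w 1 x1 g = minimax_value P N gam T w 1 x1 &
            forall g' : strategy R n lx lu,
              feedback_saddle_strategy P N gam T w x1 g' -> same_strategy T g g'],
      forall g : strategy R n lx lu,
        feedback_saddle_strategy P N gam T w x1 g ->
        forall (t : nat) (X : 'M[R]_(lx, 1 + n)), (1 <= t <= T)%N ->
          leader_action g t X
            = ulsubmx (barL N gam T t) *m leader X
              + ursubmx (barL N gam T t) *m mean X
          /\ forall i : 'I_n,
               follower_action g t i X
                 = breveL N gam T t *m follower i X
                   + dlsubmx (barL N gam T t) *m leader X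
                   + (drsubmx (barL N gam T t) - breveL N gam T t) *m mean X
    & centred P x1 ->
        minimax_value P N gam T w 1 x1 = (saddle_performance P N gam T w x1)%:E
        /\ forall (g : strategy R n lx lu) (dl : disturbance R n lx),
             feedback_saddle_point P N gam T w x1 g dl ->
             cost P N gam T w 1 x1 g dl
               = (saddle_performance P N gam T w x1)%:E ].
Proof.
have unique g dl := @feedback_saddle_unique _ _ _ _ _ _ _ _ gam _ _ _ n_gt0
  indep x1_L2 w_L2 w_mean cost_pos gam_gt0 gam_pos g dl.
have start := nonanticipative_x1 T w x1_L2.
have T1 : (1 <= 1 <= T.+1)%N by [].
have minimax := minimax_saddle n_gt0 indep x1_L2 w_L2 w_mean cost_pos gam_gt0
  gam_pos T1 start.
have saddle := feedback_saddle n_gt0 indep x1_L2 w_L2 w_mean cost_pos gam_gt0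
  gam_pos.
split.
- exists (saddle_strategy N gam T); split.
  + by exists (saddle_disturbance N gam T).
  + rewrite minimax; exact: (upper_cost_saddle n_gt0 indep x1_L2 w_L2 w_mean
      cost_pos gam_gt0 gam_pos T1 start).
  + move=> g' [dl' /unique laws] t X tT.
    by rewrite saddle_strategy_actions (laws t X tT).1.
- move=> g [dl /unique laws] t X tT; have actE := (laws t X tT).1; split.
    by rewrite -saddle_action_leader -actE leader_joint.
  by move=> i; rewrite -saddle_action_follower -actE follower_joint.
- move=> x1_mean; have valueE : saddle_value P N gam T w 1 x1
      = saddle_performance P N gam T w x1 by exact: saddle_valueE.
  rewrite minimax valueE; split=> // g dl fsp.
  rewrite (feedback_saddle_cost n_gt0 indep x1_L2 w_L2 w_mean cost_pos gam_gt0
    gam_pos fsp) -valueE.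
  exact: (cost_saddle n_gt0 indep x1_L2 w_L2 w_mean cost_pos gam_gt0 gam_pos
    T1 start).
Qed.
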